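(* Let $x_0, x_1, x_2, \ldots \in \mathbb{D}([0,T])$. Then $x_n \stackrel{*}{\longrightarrow}_S x_0$ if, and only if, $x_n(T) \to x_0(T)$ and $$\int_0^T x_n(t)\, dA_n(t) \to \int_0^T x_0(t)\, dA_0(t)$$ for each sequence $\{A_n\}_{n\ge 0} \subset \mathbb{A}([0,T])$ that satisfies $A_n \longrightarrow_{\tau} A_0$.
   Context: Fix $0<T<\infty$. $\mathbb{D}=\mathbb{D}([0,T])$ is the set of functions $x:[0,T]\to\mathbb{R}$ which are right-continuous at every $t\in[0,T)$ and have left limits at every $t\in(0,T]$; $\|x\|_\infty=\sup_{t\in[0,T]}|x(t)|$. The total variation is $\|v\|(T)=\sup\{|v(0)|+\sum_{i=1}^m|v(t_i)-v(t_{i-1})|\}$, the supremum being over all $0=t_0<t_1<\dots<t_m=T$, $m\in\mathbb{N}$, and $\mathbb{V}=\{x\in\mathbb{D}:\|x\|(T)<\infty\}$. For $v_n,v_0\in\mathbb{V}$, $v_n\Rightarrow v_0$ means $\int_{[0,T]}f\,dv_n\to\int_{[0,T]}f\,dv_0$ for every continuous $f:[0,T]\to\mathbb{R}$, where the signed measure $dv$ on $[0,T]$ is determined by $dv([0,t])=v(t)$ (in particular it has mass $v(0)$ at $0$). S-convergence (a priori): $x_n\longrightarrow_S x_0$ if for every $\varepsilon>0$ there are $v_{n,\varepsilon}\in\mathbb{V}$, $n=0,1,2,\dots$, with $\|x_n-v_{n,\varepsilon}\|_\infty\le\varepsilon$ for all $n\ge0$ and $v_{n,\varepsilon}\Rightarrow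 v_{0,\varepsilon}$ as $n\to\infty$. The $S$ topology on $\mathbb{D}$ is the sequential topology generated by $\longrightarrow_S$: a set $F\subset\mathbb{D}$ is closed iff $x_n\in F$ for $n\ge 1$ and $x_n\longrightarrow_S x_0$ imply $x_0\in F$. $x_n\stackrel{*}{\longrightarrow}_S x_0$ denotes convergence of sequences in the $S$ topology; equivalently (Kantorovich–Vulih–Pinsker–Kisyński), every subsequence of $\{x_n\}$ contains a further subsequence that converges to $x_0$ in the sense of $\longrightarrow_S$. $\mathbb{A}=\mathbb{A}([0,T])$ is the set of continuous functions $A:[0,T]\to\mathbb{R}$ of finite variation with $A(0)=0$. For $A_n\in\mathbb{A}$, $n=0,1,2,\dots$, $A_n\longrightarrow_\tau A_0$ means that $\sup_{t\in[0,T]}|A_n(t)-A_0(t)|\to0$ and $\sup_n\|A_n\|(T)<\infty$. Integrals $\int_0^T x\,dA$ are Lebesgue–Stieltjes integrals. *)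

(* Defs.v *)
From HB Require Import structures.
From mathcomp Require Import all_boot all_order all_algebra.
From mathcomp Require Import all_classical all_reals all_analysis.
From mathcomp Require Import ring.

Set Implicit Arguments.
Unset Strict Implicit.
Unset Printing Implicit Defensive.
Import Order.TTheory GRing.Theory Num.Theory.
Import numFieldNormedType.Exports.
Local Open Scope classical_set_scope.
Local Open Scope ring_scope.

(* A function on [0, T] is represented by its extension by zero to the whole
   line: [cadlag_out] makes equality in [cadlag T] the same as equality on
   [0, T]. *)
Record cadlag (R : realType) (T : R) := Cadlag {
  cadlag_fun :> R -> R ;
  cadlag_right : forall t, 0 <= t < T -> cadlag_fun @ t^'+ --> cadlag_fun t ;
  cadlag_left : forall t, 0 < t <= T -> cvg (cadlag_fun @ t^'-) ;
  cadlag_out : forall t, t \notin `[0, T] -> cadlag_fun t = 0 }.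

HB.instance Definition _ (R : realType) (T : R) := gen_eqMixin (cadlag T).
HB.instance Definition _ (R : realType) (T : R) := gen_choiceMixin (cadlag T).

(* The functionals below only look at the values of their arguments on
   [0, T]. *)
Section stieltjes.
Context {R : realType}.
Variable T : R.

Definition supnorm (f : R -> R) : \bar R :=
  ereal_sup [set `|f t|%:E | t in `[0, T]%classic].

Definition tvnorm (v : R -> R) : \bar R :=
  (`|v 0|%:E + total_variation 0 T v)%E.

(* The signed measure dv of the interval [0, T], seen as a charge on the line
   concentrated on [0, T]; its mass at 0 is v(0). *)
Definition is_stieltjes_charge (v : R -> R)
    (nu : {charge set measurableTypeR R -> \bar R}) :=
  (forall t, 0 <= t <= T -> nu `[0, t]%classic = (v t)%:E) /\
  forall B : set (measurableTypeR R), measurable B ->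
    B `&` `[0, T] = set0 -> nu B = 0%E.

(* The zero charge is a dummy value for functions v that define no charge; it
   is never used for right-continuous v of bounded variation
   ([stieltjes_chargeP] below). *)
Definition stieltjes_charge (v : R -> R) :
    {charge set measurableTypeR R -> \bar R} :=
  match pselect (exists nu, is_stieltjes_charge v nu) with
  | left ex => projT1 (cid ex)
  | right _ => czero
  end.

(* The Jordan decomposition does not depend on the Hahn decomposition chosen. *)
Definition charge_integral (nu : {charge set measurableTypeR R -> \bar R})
    (D : set (measurableTypeR R)) (f : R -> R) : R :=
  let hahn := projT2 (cid (projT2 (cid (Hahn_decomposition nu)))) in
  \int[jordan_pos hahn]_(t in D) f t - \int[jordan_neg hahn]_(t in D) f t.

Definition stieltjes_integral (f v : R -> R) : R :=
  charge_integral (stieltjes_charge v) `[0, T]%classic f.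

End stieltjes.

Section stieltjes_charge_existence.
Context {R : realType}.
Variable T : R.
Hypothesis T0 : 0 <= T.

Let clamp (t : R) : R := Num.max 0 (Num.min t T).

Let clamp_itv t : clamp t \in `[0, T].
Proof. by rewrite in_itv/= /clamp le_max lexx/= ge_max T0 ge_min lexx orbT. Qed.

Let clamp_id t : 0 <= t <= T -> clamp t = t.
Proof. by move=> /andP[t0 tT]; rewrite /clamp min_l// max_r. Qed.

Let clamp_le t : t <= 0 -> clamp t = 0.
Proof. by move=> t0; rewrite /clamp max_l// ge_min t0. Qed.

Let clamp_ge t : T <= t -> clamp t = T.
Proof. by move=> t0; rewrite /clamp min_r// max_r. Qed.

Let clamp_homo s t : s <= t -> clamp s <= clamp t.
Proof.
by move=> st; rewrite /clamp ge_max !le_max lexx/= le_min !ge_min st lexx !orbT.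
Qed.

Let increasing_charge (f : R -> R) :
  {in `[0, T] &, nondecreasing_fun f} ->
  (forall t, 0 <= t < T -> f @ t^'+ --> f t) ->
  exists nu : {charge set measurableTypeR R -> \bar R},
    (forall t, 0 <= t <= T -> nu `[0, t]%classic = (f t - f 0)%:E) /\
    forall B : set (measurableTypeR R), measurable B ->
      B `&` `[0, T] = set0 -> nu B = 0%E.
Proof.
move=> ndf rcf.
pose g := f \o clamp.
have ndg : nondecreasing g.
  by move=> s t st; apply: ndf => //; exact: clamp_homo.
have rcg : right_continuous g.
  move=> t; have [t0|t0] := ltP t 0.
    rewrite /g/= (clamp_le (ltW t0)); apply: cvg_near_cst.
    by apply: filterS (nbhs_right_le t0) => s s0; rewrite /= clamp_le.
  have [tT|tT] := ltP t T; last first.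
    rewrite /g/= (clamp_ge tT); apply: cvg_near_cst.
    apply: filterS (nbhs_right_ge t) => s ts.
    by rewrite /= clamp_ge// (le_trans tT).
  have tT' : 0 <= t < T by rewrite t0.
  rewrite {2}/g/= clamp_id ?t0 ?ltW//.
  apply: cvg_trans (rcf t tT'); apply: near_eq_cvg.
  apply: filterS2 (nbhs_right_ge t) (nbhs_right_le tT) => s ts sT.
  by rewrite /g/= clamp_id// (le_trans t0).
pose G : cumulative R R :=
  HB.pack g (isCumulative.Build R _ R g ndg rcg).
pose mu : {measure set measurableTypeR R -> \bar R} :=
  lebesgue_stieltjes_measure G.
have muE a b : a <= b -> mu `]a, b]%classic = (g b - g a)%:E.
  move=> ab; transitivity (wlength G `]a, b]); last by rewrite wlength_itv_bnd.
  by apply: measurable_mu_extE; exact: is_ocitv.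
have mD : measurable (`]0, T]%classic : set (measurableTypeR R)) by [].
have fD : (mu `]0%R, T]%classic < +oo)%E by rewrite muE// ltry.
exists (charge_of_finite_measure (mfrestr mD fD)); split.
  move=> t /andP[t0 tT].
  rewrite /charge_of_finite_measure/= /mfrestr /mrestr.
  have -> : `[0, t] `&` `]0, T] = `]0, t]%classic :> set R.
    apply/seteqP; split => s /=; rewrite !in_itv/=.
      by move=> [/andP[_ ->] /andP[->]].
    by move=> /andP[s0 st]; rewrite s0 (ltW s0) st (le_trans st tT).
  by rewrite muE// /g/= !clamp_id ?t0 ?lexx.
move=> B mB B0; rewrite /charge_of_finite_measure/= /mfrestr /mrestr.
have -> : B `&` `]0, T] = set0; last exact: measure0.
rewrite -subset0 => s [Bs]; rewrite -B0/= !in_itv/= => /andP[s0 sT]; split=>//.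
by rewrite (ltW s0).
Qed.

Lemma stieltjes_chargeP (v : R -> R) :
  (forall t, 0 <= t < T -> v @ t^'+ --> v t) -> (tvnorm T v < +oo)%E ->
  is_stieltjes_charge T v (stieltjes_charge T v).
Proof.
move=> rcv tv; rewrite /stieltjes_charge; case: pselect => [ex|].
  by case: cid.
case.
have bv : bounded_variation 0 T v.
  apply/bounded_variationP => //; rewrite ge0_fin_numE ?total_variation_ge0//.
  by apply: le_lt_trans tv; rewrite /tvnorm leeDr// lee_fin.
have bvN : bounded_variation 0 T (\- v) by exact: bounded_variationN.
have [|t /andP[t0 tT]|np [np1 np2]] :=
    @increasing_charge (fine \o neg_tv 0 (\- v)).
- exact: fine_neg_tv_nondecreasing.
- apply: (@neg_tv_right_continuous _ _ _ T) => //.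
  by apply: cvgN; apply: rcv; rewrite t0.
have [|t /andP[t0 tT]|nn [nn1 nn2]] := @increasing_charge (fine \o neg_tv 0 v).
- exact: fine_neg_tv_nondecreasing.
- apply: (@neg_tv_right_continuous _ _ _ T) => //.
  by apply: rcv; rewrite t0.
pose n0 : {charge set measurableTypeR R -> \bar R} :=
  charge_of_finite_measure (dirac (0 : measurableTypeR R)).
pose n1 : {charge set measurableTypeR R -> \bar R} := cscale (v 0) n0.
pose n2 : {charge set measurableTypeR R -> \bar R} := cscale (-1) nn.
pose n3 : {charge set measurableTypeR R -> \bar R} := cadd np n2.
exists (cadd n1 n3); split.
  move=> t tT; pose I : set (measurableTypeR R) := `[0, t]%classic.
  transitivity ((v 0)%:E * \d_(0%R : measurableTypeR R) I +
    (np I + (-1)%R%:E * nn I))%E; first by [].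
  rewrite np1// nn1// diracE.
  have /andP[t0 tT'] := tT.
  rewrite mem_set; last by rewrite /I/= in_itv/= lexx t0.
  rewrite -!EFinM -!EFinD; congr EFin.
  have /= -> := bounded_variation_pos_neg_tvE bv (_ : t \in `[0, T]); last first.
    by rewrite in_itv.
  have /= -> := bounded_variation_pos_neg_tvE bv (_ : 0 \in `[0, T]); last first.
    by rewrite in_itv/= lexx T0.
  by rewrite /pos_tv /= mulr1 mulN1r; ring.
move=> B mB B0; transitivity ((v 0)%:E * \d_(0%R : measurableTypeR R) B +
  (np B + (-1)%R%:E * nn B))%E; first by [].
rewrite np2// nn2// diracE memNset.
  by rewrite !mule0 !adde0.
move=> B00; have : (B `&` `[0, T]%classic) 0.
  by split => //=; rewrite in_itv/= lexx T0.
by rewrite B0.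
Qed.

End stieltjes_charge_existence.

Section S_topology.
Context {R : realType} {T : R}.

Definition bv_cadlag : set (cadlag T) := [set v | (tvnorm T v < +oo)%E].

Definition weak_cvg (v : nat -> cadlag T) (v0 : cadlag T) :=
  forall f : R -> R, {within `[0, T], continuous f} ->
    stieltjes_integral T f (v n) @[n --> \oo] --> stieltjes_integral T f v0.

Definition S_cvg (x : nat -> cadlag T) (x0 : cadlag T) :=
  forall e : R, 0 < e -> exists (v : nat -> cadlag T) (v0 : cadlag T),
    [/\ (forall n, bv_cadlag (v n)) /\ bv_cadlag v0,
        forall n, (supnorm T (x n \- v n)%R <= e%:E)%E,
        (supnorm T (x0 \- v0)%R <= e%:E)%E &
        weak_cvg v v0].

Definition S_closed (F : set (cadlag T)) :=
  forall (x : nat -> cadlag T) (x0 : cadlag T),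
    (forall n, F (x n)) -> S_cvg x x0 -> F x0.

Definition S_open (U : set (cadlag T)) := S_closed (~` U).

Lemma S_cvg_comp x x0 (phi : nat -> nat) :
  phi @ \oo --> \oo -> S_cvg x x0 -> S_cvg (x \o phi) x0.
Proof.
move=> phioo xx0 e /xx0[v [v0 [[Vv Vv0] xv xv0 vv0]]].
exists (v \o phi), v0; split => //; [|by move=> n; exact: xv|].
  by split=> // n; exact: Vv.
move=> f cf.
exact: (@cvg_comp _ _ _ phi (fun n => stieltjes_integral T f (v n)) _ _ _
  phioo (vv0 f cf)).
Qed.

Let S_openT : S_open setT.
Proof. by move=> x x0 /(_ 0); rewrite setCT. Qed.

Let S_openI : setI_closed S_open.
Proof.
move=> A B oA oB x x0 ABx xx0 [Ax0 Bx0].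
have [[N AN]|AN] := pselect (exists N, forall n, (N <= n)%N -> A (x n)).
  have : (fun n => n + N)%N @ \oo --> \oo by exact: cvg_addnr.
  move=> /S_cvg_comp/(_ xx0)/oB; apply => // n /= Bn.
  by apply: (ABx (n + N)%N); split => //; apply: AN; rewrite leq_addl.
have /choice[phi phiP] : forall N, exists n, (N <= n)%N /\ ~ A (x n).
  move=> N; apply: contra_notP AN => h; exists N => n Nn.
  by apply: contrapT => nA; apply: h; exists n.
have phioo : phi @ \oo --> \oo.
  move=> P [N _ NP]; exists N => // n /= Nn; apply: NP => /=.
  by rewrite (leq_trans Nn)//; case: (phiP n).
by apply: (oA _ _ _ (S_cvg_comp phioo xx0)) => // n; case: (phiP n).
Qed.

Let S_open_bigcup (I : Type) (f : I -> set (cadlag T)) :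
  (forall i, S_open (f i)) -> S_open (\bigcup_i f i).
Proof.
move=> of_ x x0 fx xx0 [i _ fi].
by apply: (of_ i x x0) => // n fin; apply: (fx n); exists i.
Qed.

(* The topology of [cadlag T] is the sequential topology generated by
   [S_cvg]. *)
HB.instance Definition _ :=
  isOpenTopological.Build (cadlag T) S_openT S_openI S_open_bigcup.

End S_topology.

Section tau.
Context {R : realType}.
Variable T : R.

Definition continuous_bv : set (R -> R) :=
  [set A | [/\ {within `[0, T], continuous A}, (tvnorm T A < +oo)%E & A 0 = 0]].

Definition tau_cvg (A : nat -> R -> R) (A0 : R -> R) :=
  supnorm T (A n \- A0) @[n --> \oo] --> 0%E /\
  (ereal_sup (range (fun n => tvnorm T (A n))) < +oo)%E.

End tau.

(* Main.v *)
Require Import Defs.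
From mathcomp Require Import all_boot all_order all_algebra.
From mathcomp Require Import all_classical all_reals all_analysis.
From mathcomp Require Import measurable_realfun lra ring.
Import Order.TTheory GRing.Theory Num.Theory.
Import numFieldNormedType.Exports.
Set Implicit Arguments.
Unset Strict Implicit.
Unset Printing Implicit Defensive.
Local Open Scope classical_set_scope.
Local Open Scope ring_scope.

(* Write I x A for the integral of x with respect to dA.

   If x_n S-converges to x_0, replace x_n by a nearby v_n of bounded variation;
   integration by parts turns I v_n A_n into v_n(T) A_n(T) - I A_n v_n, and a
   gliding hump argument shows that I (A_n - A_0) v_n tends to 0, so that the
   uniform boundedness principle is not needed.

   Conversely, testing against integrators A that are uniformly small but of
   bounded variation gives an equicontinuity property of the functionals
   I x_n. Steep ramps located at t make I x_n A close to x_n(t), hence the x_n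
   are uniformly bounded; telescoping sums of k ramps with weight 1/k are
   bounded by 1/k with variation at most 2, hence the number of oscillations of
   x_n larger than e is bounded. So x_n is within e of a step function with a
   bounded number of jumps of bounded size, and compactness of these jump data
   (for all e = 1/(m+1) at once) produces an S-convergent subsequence, whose
   limit is identified with x_0 by ramps again. *)

(** The integral rests on a charge obtained by choice and on its Jordan decomposition, neither of
    which is visibly linear in the integrator. Linearity and integration by parts are therefore read
    off from Riemann-Stieltjes sums: for a fixed integrator the sum differs from the integral by at
    most [C * d], where [C] is the mass of the charge and [d] the tolerance of the mesh, and [d] is
    arbitrary.

    A continuous integrator has no atom at [T], so no integral sees the value of x_n at [T]. This is
    why convergence at [T] is a separate condition, and why ramps are placed only at t < T.

    Convergence in the topology is weaker than S-convergence, but one S-convergent subsequence of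
    any sequence staying outside a neighbourhood of x_0 is enough for the converse, since
    complements of open sets are closed under S-limits. *)

(** Serves to equate integrals that lie within a constant times [d] of the same Riemann-Stieltjes
    sum, for every tolerance [d]. *)
Lemma eq_of_le_scale {R : realFieldType} (a b C : R) : 0 <= C ->
  (forall d, 0 < d -> `|a - b| <= C * d) -> a = b.
Proof.
move=> C0 abC; apply/eqP; rewrite -subr_eq0 -normr_le0 leNgt; apply/negP => ab.
have C1 : 0 < C + 1 by rewrite ltr_wpDl.
have := abC _ (divr_gt0 ab C1); rewrite mulrCA ler_pMr// ler_pdivlMr// mul1r.
by rewrite gerDl ler10.
Qed.

Lemma dist_thirds {R : realFieldType} (a0 b0 b a e : R) :
  `|a0 - b0| <= e / 3 -> `|b0 - b| <= e / 3 -> `|a - b| <= e / 3 -> `|a0 - a| <= e.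
Proof. by rewrite !ler_norml; lra. Qed.

Lemma dist_add_le {R : realFieldType} (s p q a b e e1 e2 : R) :
  `|s - (p + q)| <= e -> `|a - p| <= e1 -> `|b - q| <= e2 ->
  `|s - (a + b)| <= e + (e1 + e2).
Proof. by rewrite !ler_norml; lra. Qed.

Lemma dist_sub_le {R : realFieldType} (s x p a e e1 : R) :
  `|s - (x - p)| <= e -> `|a - p| <= e1 -> `|s - (x - a)| <= e + e1.
Proof. by rewrite !ler_norml; lra. Qed.

Lemma dist_scale_le {R : realFieldType} (s c p a e e1 : R) :
  `|s - c * p| <= e -> `|a - p| <= e1 -> `|s - c * a| <= e + `|c| * e1.
Proof.
move=> h h1; have -> : s - c * a = (s - c * p) - c * (a - p) by ring.
by apply: le_trans (ler_normB _ _) _; rewrite lerD// normrM ler_wpM2l.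
Qed.

(** * Integration against a charge *)

Section charge_integral.
Context {R : realType}.
Implicit Types (nu : {charge set measurableTypeR R -> \bar R}).
Implicit Types (D B : set (measurableTypeR R)) (f g : R -> R).

Definition bounded_measurable D f :=
  measurable_fun D (f : measurableTypeR R -> R) /\ exists M, forall t, D t -> `|f t| <= M.

Lemma bounded_measurable_integrable
    (mu : {finite_measure set (measurableTypeR R) -> \bar R}) D f :
  measurable D -> bounded_measurable D f -> mu.-integrable D (EFin \o f).
Proof.
move=> mD [mf [M fM]]; apply: measurable_bounded_integrable => //.
  by rewrite ltey_eq fin_num_measure.
exists M; split; rewrite ?num_real// => r Mr t Dt.
exact: le_trans (fM t Dt) (ltW Mr).
Qed.

Lemma bounded_measurableD D f g : bounded_measurable D f -> bounded_measurable D g ->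
  bounded_measurable D (f \+ g).
Proof.
move=> [mf [M fM]] [mg [N gN]]; split; first exact: measurable_funD.
exists (M + N) => t Dt; apply: le_trans (ler_normD _ _) _.
by apply: lerD; [exact: fM|exact: gN].
Qed.

Lemma bounded_measurableZ D c f : bounded_measurable D f ->
  bounded_measurable D (fun t => c * f t).
Proof.
move=> [mf [M fM]]; split; first exact: measurable_funM.
by exists (`|c| * M) => t Dt; rewrite normrM ler_wpM2l// fM.
Qed.

Lemma bounded_measurableB D f g : bounded_measurable D f -> bounded_measurable D g ->
  bounded_measurable D (f \- g).
Proof.
move=> bf /(bounded_measurableZ (-1)) /(bounded_measurableD bf).
by congr bounded_measurable; apply/funext => t /=; rewrite mulN1r.
Qed.

Lemma bounded_measurable_indic D B : measurable B ->
  bounded_measurable D (\1_B).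
Proof.
move=> mB; split; first exact: measurable_indic.
by exists 1 => t _; rewrite indicE; case: (_ \in _); rewrite /= ?normr1 ?normr0.
Qed.

Lemma charge_integralD nu D f g : measurable D ->
  bounded_measurable D f -> bounded_measurable D g ->
  charge_integral nu D (f \+ g) = charge_integral nu D f + charge_integral nu D g.
Proof.
move=> mD bf bg; rewrite /charge_integral/= !RintegralD//; first by ring.
all: exact: bounded_measurable_integrable.
Qed.

Lemma charge_integralZ nu D c f : measurable D -> bounded_measurable D f ->
  charge_integral nu D (fun t => c * f t) = c * charge_integral nu D f.
Proof.
move=> mD bf; rewrite /charge_integral/= !RintegralZl//; first by ring.
all: exact: bounded_measurable_integrable.
Qed.

Lemma eq_charge_integral nu D f g : {in D, f =1 g} ->
  charge_integral nu D f = charge_integral nu D g.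
Proof. by move=> fg; rewrite /charge_integral !(eq_Rintegral _ fg). Qed.

Lemma charge_integral_indic nu D B : measurable D -> measurable B -> B `<=` D ->
  charge_integral nu D (\1_B) = fine (nu B).
Proof.
move=> mD mB BD; rewrite /charge_integral.
move: (projT2 (cid (projT2 (cid (Hahn_decomposition nu))))) => /= h.
rewrite (jordan_decomp h mB) /cadd/= cscaleN1 /Rintegral !integral_indic//.
rewrite (setIidl BD) [RHS]fineB//; first exact: fin_num_measure.
exact: fin_num_measure.
Qed.

(** The witness is the mass of [D] under the total variation of [nu]; what matters later is that it
    does not depend on [f]. *)
Lemma charge_integral_bound nu D : measurable D -> exists2 C, 0 <= C &
  forall f M, measurable_fun D (f : measurableTypeR R -> R) ->
    (forall t, D t -> `|f t| <= M) -> `|charge_integral nu D f| <= C * M.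
Proof.
move=> mD; rewrite /charge_integral.
move: (projT2 (cid (projT2 (cid (Hahn_decomposition nu))))) => /= h.
exists (fine (jordan_pos h D) + fine (jordan_neg h D)).
  by apply: addr_ge0; apply: fine_ge0.
move=> f M mf fM.
have key (mu : {finite_measure set (measurableTypeR R) -> \bar R}) :
    `|\int[mu]_(t in D) f t| <= fine (mu D) * M.
  have bf : bounded_measurable D f by split => //; exists M.
  apply: le_trans (le_normr_Rintegral mD _) _.
    exact: bounded_measurable_integrable.
  have -> : fine (mu D) * M = \int[mu]_(t in D) cst M t.
    by rewrite Rintegral_cst// mulrC.
  apply: le_Rintegral => //.
    apply: (@bounded_measurable_integrable mu D (fun t => `|f t|)) => //.
    split; first exact: measurableT_comp.
    by exists M => t Dt; rewrite normr_id fM.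
  apply: (@bounded_measurable_integrable mu D (fun t => M)) => //.
  by split; [exact: measurable_cst|exists `|M|].
apply: le_trans (ler_normB _ _) _; rewrite mulrDl.
by apply: lerD; exact: key.
Qed.

End charge_integral.

(** * Partitions, step functions and Riemann-Stieltjes sums *)

Section partitions.
Context {R : realType}.
Implicit Types (P : R -> R -> Prop) (a b t : R) (s : seq R) (f v : R -> R).

(** A [Prop]-valued analogue of [path]: [s] lists the successive right endpoints of the cells that
    start from [a]. *)
Fixpoint mesh P a s : Prop :=
  if s is b :: s' then P a b /\ mesh P b s' else True.

Lemma mesh_rcons P a s b : mesh P a s -> P (last a s) b -> mesh P a (rcons s b).
Proof. by elim: s a => //= c s IHs a [Pac /IHs{}IHs] /IHs. Qed.

Lemma mesh_sub P Q a s : (forall a b, P a b -> Q a b) -> mesh P a s -> mesh Q a s.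
Proof. by move=> PQ; elim: s a => //= c s IHs a [/PQ Qac /IHs]. Qed.

(** Real induction: the supremum of the points reachable from [a] is itself reachable by the
    condition on the left, and the condition on the right would carry the chain beyond it if it were
    less than [b]. As [P] is arbitrary, several fineness conditions can be imposed on one
    partition. *)
Lemma partition_exists P a b : a <= b ->
  (forall t, a <= t < b -> \forall u \near t^'+, P t u) ->
  (forall t, a < t <= b -> \forall u \near t^'-, P u t) ->
  exists2 s, mesh P a s & last a s = b.
Proof.
move=> ab Pr Pl.
pose S := [set t | a <= t <= b /\ exists2 s, mesh P a s & last a s = t].
have Sa : S a by split; [rewrite lexx|exists [::]].
have supS : has_sup S.
  by split; [exists a|exists b => t [/andP[_]]].
have ac : a <= sup S by exact: ub_le_sup (supS.2) _ Sa.
have cb : sup S <= b by apply: ge_sup => [|t [/andP[_]]]; [exists a|].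
have Sc : S (sup S).
  move: ac; rewrite le_eqVlt => /predU1P[<-//|ac].
  split; first by rewrite cb (ltW ac).
  have [|d/= d0 dP] := Pl (sup S); first by rewrite ac cb.
  have [t St tc] := sup_adherent d0 supS.
  have tS : t <= sup S by exact: ub_le_sup (supS.2) _ St.
  move: tS; rewrite le_eqVlt => /predU1P[<-//|tS]; first by case: St.
  case: St => _ [s ms ls]; exists (rcons s (sup S)); last by rewrite last_rcons.
  apply: mesh_rcons => //; rewrite ls; apply: dP => //=.
  by rewrite gtr0_norm ?subr_gt0// ltrBlDr addrC -ltrBlDr.
move: cb; rewrite le_eqVlt => /predU1P[<-//|cb]; first by case: Sc.
have cP := Pr (sup S); rewrite ac cb in cP.
have [u [Pu /andP[cu ub]]] : exists u, P (sup S) u /\ sup S < u <= b.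
  apply: (@filter_ex _ (sup S)^'+).
  near=> u; split; first by near: u; exact: cP.
  by apply/andP; split; near: u; [exact: nbhs_right_gt|exact: nbhs_right_le].
suff : S u by move/(ub_le_sup supS.2); rewrite leNgt cu.
split; first by rewrite ub (le_trans ac (ltW cu)).
case: Sc => _ [s ms ls]; exists (rcons s u); last by rewrite last_rcons.
by apply: mesh_rcons => //; rewrite ls.
Unshelve. all: by end_near. Qed.

(** [rstep] approximates cadlag integrands on cells [a, b[, whose charge is known for continuous
    integrators; [lstep] approximates continuous integrands on cells ]a, b], whose charge is known
    for all right-continuous integrators of bounded variation. *)
Fixpoint rstep f a s t : R :=
  if s is b :: s' then f a * \1_(`[a, b[%classic) t + rstep f b s' t else 0.

Fixpoint lstep f a s t : R :=
  if s is b :: s' then f b * \1_(`]a, b]%classic) t + lstep f b s' t else 0.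

Fixpoint rsum f v a s : R :=
  if s is b :: s' then f a * (v b - v a) + rsum f v b s' else 0.

Fixpoint lsum f v a s : R :=
  if s is b :: s' then f b * (v b - v a) + lsum f v b s' else 0.

(** The right endpoint is left out because a cadlag function may jump there. *)
Definition rmesh f d a b := a < b /\ forall t, a <= t < b -> `|f t - f a| <= d.

Definition lmesh f d a b := a < b /\ forall t, a < t <= b -> `|f t - f b| <= d.

Definition ltmesh a b : Prop := a < b.

Lemma mesh_lt_last a s : mesh ltmesh a s -> a <= last a s.
Proof.
elim: s a => //= b s IHs a [ab /IHs]; apply: le_trans; exact: ltW.
Qed.

Lemma rstep0 f a s t : mesh ltmesh a s -> t < a -> rstep f a s t = 0.
Proof.
elim: s a => //= b s IHs a [ab ms] ta.
rewrite IHs//; last exact: lt_trans ab.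
by rewrite indicE memNset ?mulr0 ?addr0//= in_itv/= leNgt ta.
Qed.

Lemma rstep_last f a s t : mesh ltmesh a s -> last a s <= t -> rstep f a s t = 0.
Proof.
elim: s a => //= b s IHs a [ab ms] ta.
rewrite IHs// indicE memNset ?mulr0 ?addr0//= in_itv/= ltNge.
by rewrite (le_trans (mesh_lt_last ms) ta) andbF.
Qed.

Lemma rstep_approx f d a s t : mesh (rmesh f d) a s -> a <= t < last a s ->
  `|f t - rstep f a s t| <= d.
Proof.
elim: s a => /= [a _|b s IHs a [[ab fab] ms] /andP[a_t tl]].
  by move=> /andP[/le_lt_trans] h /h; rewrite ltxx.
have ms' : mesh ltmesh b s by apply: mesh_sub ms => ? ? [].
have [tb|bt] := ltP t b.
  rewrite rstep0// addr0 indicE mem_set/= ?in_itv/= ?a_t//.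
  by rewrite mulr1 fab// a_t.
rewrite indicE memNset ?mulr0 ?add0r/= ?IHs ?bt//.
by rewrite in_itv/= ltNge bt andbF.
Qed.

Lemma lstep0 f a s t : mesh ltmesh a s -> t <= a -> lstep f a s t = 0.
Proof.
elim: s a => //= b s IHs a [ab ms] ta.
rewrite IHs//; last exact: le_trans ta (ltW ab).
by rewrite indicE memNset ?mulr0 ?addr0//= in_itv/= ltNge ta.
Qed.

Lemma lstep_approx f d a s t : mesh (lmesh f d) a s -> a < t <= last a s ->
  `|f t - lstep f a s t| <= d.
Proof.
elim: s a => /= [a _|b s IHs a [[ab fab] ms] /andP[a_t tl]].
  by move=> /andP[/lt_le_trans] h /h; rewrite ltxx.
have ms' : mesh ltmesh b s by apply: mesh_sub ms => ? ? [].
have [tb|bt] := leP t b.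
  rewrite lstep0// addr0 indicE mem_set/= ?in_itv/= ?a_t//.
  by rewrite mulr1 fab// a_t.
rewrite indicE memNset ?mulr0 ?add0r/= ?IHs ?bt//.
by rewrite in_itv/= leNgt bt andbF.
Qed.

Lemma rsumDr f v w a s : rsum f (v \+ w) a s = rsum f v a s + rsum f w a s.
Proof. by elim: s a => [a|b s IHs a] /=; rewrite ?addr0// IHs; ring. Qed.

Lemma rsumZr f c v a s : rsum f (fun t => c * v t) a s = c * rsum f v a s.
Proof. by elim: s a => [a|b s IHs a] /=; rewrite ?mulr0// IHs; ring. Qed.

Lemma lsumDr f v w a s : lsum f (v \+ w) a s = lsum f v a s + lsum f w a s.
Proof. by elim: s a => [a|b s IHs a] /=; rewrite ?addr0// IHs; ring. Qed.

Lemma lsumZr f c v a s : lsum f (fun t => c * v t) a s = c * lsum f v a s.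
Proof. by elim: s a => [a|b s IHs a] /=; rewrite ?mulr0// IHs; ring. Qed.

(** Abel summation: exchanging the roles of [f] and [v] turns left endpoints into right endpoints.
    Integration by parts thus asks for one partition that is an [rmesh] for one function and an
    [lmesh] for the other. *)
Lemma rsum_by_parts f v a s :
  rsum f v a s = f (last a s) * v (last a s) - f a * v a - lsum v f a s.
Proof. by elim: s a => [a|b s IHs a] /=; rewrite ?subr0 ?subrr// IHs; ring. Qed.

Lemma rsum_total_variation f v M a s : mesh ltmesh a s ->
  (forall t, a <= t < last a s -> `|f t| <= M) ->
  (`|rsum f v a s|%:E <= M%:E * total_variation a (last a s) v)%E.
Proof.
elim: s a => /= [a _ _|b s IHs a [ab ms] fM].
  by rewrite normr0 total_variationxx mule0.
have bl := mesh_lt_last ms.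
have fa : `|f a| <= M by apply: fM; rewrite lexx (lt_le_trans ab bl).
have M0 : 0 <= M by exact: le_trans fa.
rewrite (total_variationD v (ltW ab) bl) ge0_muleDr ?total_variation_ge0 ?(ltW ab)//.
apply: (@le_trans _ _ (`|f a * (v b - v a)|%:E + `|rsum f v b s|%:E)%E).
  by rewrite -EFinD lee_fin ler_normD.
apply: leeD; last first.
  by apply: IHs => // t /andP[bt tl]; rewrite fM// tl (le_trans (ltW ab)).
rewrite normrM EFinM; apply: lee_pmul => //.
by apply: total_variation_ge; exact: ltW.
Qed.

End partitions.

(** * Cadlag and continuous functions on [0, T]: fine partitions and measurability *)

Section cadlag_on.
Context {R : realType}.
Variable T : R.
Hypothesis T0 : 0 < T.
Implicit Types (f v : R -> R).

(** Stated for bare functions, so that sums and differences need not be packed into the record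
    [cadlag]. *)
Definition cadlag_on f := (forall t, 0 <= t < T -> f @ t^'+ --> f t) /\
  forall t, 0 < t <= T -> cvg (f @ t^'-).

Definition continuous_on f := (forall t, 0 <= t < T -> f @ t^'+ --> f t) /\
  forall t, 0 < t <= T -> f @ t^'- --> f t.

Lemma cadlag_cadlag_on (x : cadlag T) : cadlag_on x.
Proof. by split; [exact: cadlag_right|exact: cadlag_left]. Qed.

Lemma continuous_onP f : {within `[0, T], continuous f} <-> continuous_on f.
Proof.
split=> [/(continuous_within_itvP f T0)[fo f0 fT]|[fr fl]].
  split=> t.
    rewrite le_eqVlt => /andP[/predU1P[<-//|t0 tT]].
    by apply: cvg_at_right_filter; apply: fo; rewrite in_itv/= t0.
  rewrite le_eqVlt => /andP[t0 /predU1P[->//|tT]].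
  by apply: cvg_at_left_filter; apply: fo; rewrite in_itv/= t0.
apply/(continuous_within_itvP f T0); split.
- move=> t; rewrite in_itv/= => /andP[t0 tT].
  apply/left_right_continuousP; split; first by apply: fl; rewrite t0 ltW.
  by apply: fr; rewrite tT ltW.
- by apply: fr; rewrite lexx.
- by apply: fl; rewrite lexx T0.
Qed.

Lemma continuous_on_cadlag_on f : continuous_on f -> cadlag_on f.
Proof. by move=> [fr fl]; split => // t /fl fl'; apply/cvg_ex; exists (f t). Qed.

Lemma cadlag_onD f g : cadlag_on f -> cadlag_on g -> cadlag_on (f \+ g).
Proof.
move=> [fr fl] [gr gl]; split=> t tT.
  by apply: cvgD; [exact: fr|exact: gr].
by apply: is_cvgD; [exact: fl|exact: gl].
Qed.

Lemma cadlag_onZ c f : cadlag_on f -> cadlag_on (fun t => c * f t).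
Proof.
move=> [fr fl]; split=> t tT; first by apply: cvgM; [exact: cvg_cst|exact: fr].
by apply: is_cvgM; [exact: is_cvg_cst|exact: fl].
Qed.

Lemma cadlag_onB f g : cadlag_on f -> cadlag_on g -> cadlag_on (f \- g).
Proof.
move=> cf /(cadlag_onZ (-1)) /(cadlag_onD cf); congr cadlag_on.
by apply/funext => t /=; rewrite mulN1r.
Qed.

Lemma near_rmesh f d t : 0 < d -> f @ t^'+ --> f t ->
  \forall u \near t^'+, rmesh f d t u.
Proof.
move=> d0 /cvgrPdist_le/(_ _ d0)[e/= e0 ed].
near=> u; split; first by near: u; exact: nbhs_right_gt.
move=> s /andP[]; rewrite le_eqVlt => /predU1P[<-|ts su].
  by rewrite subrr normr0 ltW.
rewrite distrC ed//= ltr0_norm ?subr_lt0// opprB ltrBlDr addrC (lt_trans su)//.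
by near: u; apply: nbhs_right_lt; rewrite ltrDl.
Unshelve. all: by end_near. Qed.

(** Just before [t] all values lie within [d / 2] of the left limit, hence within [d] of each other;
    [f t] does not enter since [rmesh] excludes the right endpoint. *)
Lemma near_rmesh_left f d t : 0 < d -> cvg (f @ t^'-) ->
  \forall u \near t^'-, rmesh f d u t.
Proof.
move=> d0 /cvgrPdist_le; have d20 : 0 < d / 2 by rewrite divr_gt0.
move=> /(_ _ d20)[e/= e0 ed].
have {}ed s : t - e < s -> s < t -> `|lim (f @ t^'-) - f s| <= d / 2.
  move=> s1 s2; apply: ed => //=; rewrite gtr0_norm ?subr_gt0//.
  by rewrite ltrBlDr addrC -ltrBlDr.
near=> u.
have ut : u < t by near: u; exact: nbhs_left_lt.
have eu : t - e < u by near: u; apply: nbhs_left_gt; rewrite ltrBlDr ltrDl.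
split=> // s /andP[us st].
rewrite (_ : _ - _ = (lim (f @ t^'-) - f u) - (lim (f @ t^'-) - f s)); last by ring.
apply: le_trans (ler_normB _ _) _; rewrite [leRHS]splitr.
by apply: lerD; apply: ed => //; exact: lt_le_trans us.
Unshelve. all: by end_near. Qed.

Lemma near_lmesh_right f d t : 0 < d -> f @ t^'+ --> f t ->
  \forall u \near t^'+, lmesh f d t u.
Proof.
move=> d0 /cvgrPdist_le; have d20 : 0 < d / 2 by rewrite divr_gt0.
move=> /(_ _ d20)[e/= e0 ed].
have {}ed s : t < s -> s < t + e -> `|f t - f s| <= d / 2.
  move=> s1 s2; apply: ed => //=; rewrite ltr0_norm ?subr_lt0//.
  by rewrite opprB ltrBlDr addrC.
near=> u.
have ut : t < u by near: u; exact: nbhs_right_gt.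
have eu : u < t + e by near: u; apply: nbhs_right_lt; rewrite ltrDl.
split=> // s /andP[us st].
rewrite (_ : _ - _ = (f t - f u) - (f t - f s)); last by ring.
apply: le_trans (ler_normB _ _) _; rewrite [leRHS]splitr.
by apply: lerD; apply: ed => //; exact: le_lt_trans st _.
Unshelve. all: by end_near. Qed.

Lemma near_lmesh f d t : 0 < d -> f @ t^'- --> f t ->
  \forall u \near t^'-, lmesh f d u t.
Proof.
move=> d0 /cvgrPdist_le/(_ _ d0)[e/= e0 ed].
near=> u; split; first by near: u; exact: nbhs_left_lt.
move=> s /andP[us]; rewrite le_eqVlt => /predU1P[->|ts].
  by rewrite subrr normr0 ltW.
rewrite distrC ed//= gtr0_norm ?subr_gt0// ltrBlDr addrC -ltrBlDr (lt_trans _ us)//.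
by near: u; apply: nbhs_left_gt; rewrite ltrBlDr ltrDl.
Unshelve. all: by end_near. Qed.

Lemma cadlag_rmesh x d : 0 < d -> cadlag_on x ->
  exists2 s, mesh (rmesh x d) 0 s & last 0 s = T.
Proof.
move=> d0 [xr xl]; apply: partition_exists => [|t tT|t tT]; first exact: ltW.
  by apply: near_rmesh => //; exact: xr.
by apply: near_rmesh_left => //; exact: xl.
Qed.

Lemma cadlag_continuous_mesh x f d : 0 < d -> cadlag_on x -> continuous_on f ->
  exists s, [/\ mesh (rmesh x d) 0 s, mesh (lmesh f d) 0 s & last 0 s = T].
Proof.
move=> d0 [xr xl] [fr fl].
have [|t tT|t tT|s ms ls] :=
    @partition_exists _ (fun a b => rmesh x d a b /\ lmesh f d a b) 0 T.
- exact: ltW.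
- apply: filterI; first by apply: near_rmesh => //; exact: xr.
  by apply: near_lmesh_right => //; exact: fr.
- apply: filterI; first by apply: near_rmesh_left => //; exact: xl.
  by apply: near_lmesh => //; exact: fl.
by exists s; split => //; apply: mesh_sub ms => a b [].
Qed.

Lemma bounded_measurable_rstep D f a s : bounded_measurable D (rstep f a s).
Proof.
elim: s a => /= [a|b s IHs a].
  by split; [exact: measurable_cst|exists 0 => t; rewrite normr0].
apply: bounded_measurableD => //; apply: bounded_measurableZ.
exact: bounded_measurable_indic.
Qed.

Lemma bounded_measurable_lstep D f a s : bounded_measurable D (lstep f a s).
Proof.
elim: s a => /= [a|b s IHs a].
  by split; [exact: measurable_cst|exists 0 => t; rewrite normr0].
apply: bounded_measurableD => //; apply: bounded_measurableZ.
exact: bounded_measurable_indic.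
Qed.

(** The cells [a, b[ miss the point [T], which is added separately. *)
Let point_rstep f s : R -> R := rstep f 0 s \+ (fun t => f T * \1_[set T] t).

Lemma point_rstep_approx f d s t : mesh (rmesh f d) 0 s -> last 0 s = T ->
  0 <= d -> 0 <= t <= T -> `|f t - point_rstep f s t| <= d.
Proof.
move=> ms ls d0 /andP[t0]; have ms' := mesh_sub (fun _ _ => @proj1 _ _) ms.
rewrite le_eqVlt /point_rstep/= => /predU1P[->|tT].
  by rewrite rstep_last ?ls// add0r indicE mem_set// mulr1 subrr normr0.
rewrite indicE memNset/=; last by move=> tT'; rewrite tT' ltxx in tT.
by rewrite mulr0 addr0 rstep_approx// t0 ls.
Qed.

(** Measurability comes from uniform approximation by step functions; the mesh of tolerance 1
    already gives a bound. *)
Lemma cadlag_bounded_measurable x : cadlag_on x ->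
  bounded_measurable `[0, T]%classic x.
Proof.
move=> cx.
have bm s : bounded_measurable `[0, T]%classic (point_rstep x s).
  apply: bounded_measurableD; first exact: bounded_measurable_rstep.
  by apply: bounded_measurableZ; exact: bounded_measurable_indic.
split; last first.
  have [s ms ls] := cadlag_rmesh ltr01 cx.
  have [_ [M sM]] := bm s; exists (1 + M) => t tT.
  rewrite (_ : x t = x t - point_rstep x s t + point_rstep x s t); last by ring.
  apply: le_trans (ler_normD _ _) _; apply: lerD; last exact: sM.
  exact: point_rstep_approx.
have /choice[s sP] : forall n : nat, exists s,
    mesh (rmesh x n.+1%:R^-1) 0 s /\ last 0 s = T.
  by move=> n; have [|s ms ls] := @cadlag_rmesh x n.+1%:R^-1 _ cx; [|exists s].
apply: (@measurable_fun_cvg _ _ _ _ (fun n => point_rstep x (s n))).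
  by move=> n; case: (bm (s n)).
move=> t /= tT; apply/cvgrPdist_le => e e0; near=> n.
have [ms ls] := sP n; apply: (@le_trans _ _ n.+1%:R^-1).
  by apply: point_rstep_approx; rewrite // invr_ge0.
by apply: ltW; near: n; exact: (near_infty_natSinv_lt (PosNum e0)).
Unshelve. all: by end_near. Qed.

End cadlag_on.

(** * The Stieltjes integral *)

Lemma nondecreasing_cvg_charge {R : realType}
    (nu : {charge set measurableTypeR R -> \bar R}) (F : nat -> set (measurableTypeR R)) :
  (forall n, measurable (F n)) -> nondecreasing_seq F ->
  nu (F n) @[n --> \oo] --> nu (\bigcup_n F n).
Proof.
move=> mF ndF; have mUF : measurable (\bigcup_n F n) by exact: bigcupT_measurable.
have [P [N h]] := Hahn_decomposition nu.
under eq_fun do rewrite (jordan_decomp h (mF _)) /cadd/= cscaleN1.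
rewrite (jordan_decomp h mUF) /cadd/= cscaleN1.
apply: cvgeD.
- by rewrite fin_num_adde_defl// fin_numN fin_num_measure.
- exact: nondecreasing_cvg_mu.
- by apply: cvgeN; exact: nondecreasing_cvg_mu.
Qed.

Section stieltjes.
Context {R : realType}.
Variable T : R.
Hypothesis T0 : 0 < T.
Implicit Types (f v x A : R -> R).

Definition integrator v :=
  (forall t, 0 <= t < T -> v @ t^'+ --> v t) /\ (tvnorm T v < +oo)%E.

Lemma continuous_bv_integrator A : continuous_bv T A -> integrator A.
Proof. by move=> [/(continuous_onP T0)[]]. Qed.

Local Notation nu v := (stieltjes_charge T v).

Let chargeP v : integrator v -> is_stieltjes_charge T v (nu v).
Proof. by move=> [rv tv]; apply: stieltjes_chargeP => //; exact: ltW. Qed.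

Lemma stieltjes_charge_cc v t : integrator v -> 0 <= t <= T ->
  nu v `[0, t]%classic = (v t)%:E.
Proof. by move=> /chargeP[+ _]; apply. Qed.

Let charge_diff (m : {charge set measurableTypeR R -> \bar R})
    (A B C : set (measurableTypeR R)) (a b : R) :
  measurable A -> measurable B -> m A = a%:E -> m B = b%:E -> B `<=` A ->
  C = A `\` B -> m C = (a - b)%:E.
Proof.
by move=> mA mB mAa mBb BA ->; rewrite chargeD// (setIidr BA) mAa mBb EFinB.
Qed.

Lemma stieltjes_charge_oc v a b : integrator v -> 0 <= a -> a <= b -> b <= T ->
  nu v `]a, b]%classic = (v b - v a)%:E.
Proof.
move=> iv a0 ab bT.
have cb := stieltjes_charge_cc iv (introT andP (conj (le_trans a0 ab) bT)).
have ca := stieltjes_charge_cc iv (introT andP (conj a0 (le_trans ab bT))).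
apply: charge_diff cb ca _ _ => //.
  by apply: subset_itvl; rewrite bnd_simp.
apply/seteqP; split => t /=; rewrite !in_itv/=.
  move=> /andP[at_ tb]; rewrite tb (le_trans a0 (ltW at_)); split => //.
  by apply/negP; rewrite negb_and -!ltNge at_ orbT.
by move=> [/andP[-> ->] /negP]; rewrite andbT -ltNge.
Qed.

Lemma stieltjes_charge_set1 v : integrator v -> nu v [set 0] = (v 0)%:E.
Proof.
by move=> iv; rewrite -set_itv1 stieltjes_charge_cc// lexx ltW.
Qed.

(** Left continuity of [A] enters here: [0, t[ is exhausted by closed intervals, on which the charge
    is prescribed. *)
Lemma stieltjes_charge_0co A t : continuous_bv T A -> 0 <= t <= T ->
  nu A `[0, t[%classic = (A t)%:E.
Proof.
move=> cA; have iA := continuous_bv_integrator cA; case: cA => cA _ A0.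
rewrite le_eqVlt => /andP[/predU1P[<- _|t0 tT]].
  by rewrite set_itv_ge ?charge0 ?A0// bnd_simp ltxx.
pose u n := t - t * n.+1%:R^-1.
have ut n : u n < t by rewrite /u ltrBlDr ltrDl mulr_gt0// invr_gt0.
have u0 n : 0 <= u n.
  by rewrite subr_ge0 ler_piMr ?(ltW t0)// invf_le1 ?ler1n// ltr0n.
have uc : u n @[n --> \oo] --> t.
  rewrite -[X in _ --> X]subr0; apply: cvgB; first exact: cvg_cst.
  rewrite -[X in _ --> X](mulr0 t); apply: cvgM; first exact: cvg_cst.
  exact: cvg_harmonic.
have e : `[0, t[%classic = \bigcup_n `[0, u n]%classic :> set R.
  apply/seteqP; split => s /=; rewrite in_itv/=.
    move=> /andP[s0 st].
    have : \forall n \near \oo, s < u n by move/cvgr_gt : uc; apply.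
    by move=> /filter_ex[n sn]; exists n => //=; rewrite in_itv/= s0 ltW.
  move=> [n _] /=; rewrite in_itv/= => /andP[-> su] /=.
  exact: le_lt_trans (ut n).
have m : nu A `[0, u n]%classic @[n --> \oo] --> nu A `[0, t[%classic.
  rewrite e; apply: nondecreasing_cvg_charge => // n p np.
  apply/subsetPset; apply: subset_itvl; rewrite bnd_simp.
  by rewrite lerB// ler_wpM2l ?(ltW t0)// lef_pV2 ?posrE// ler_nat.
apply: (cvg_unique _ m) => //.
rewrite (_ : (fun n => _) = fun n => (A (u n))%:E); last first.
  apply/funext => n; rewrite stieltjes_charge_cc// u0/=.
  exact: le_trans (ltW (ut n)) tT.
apply: cvg_EFin; first by near=> n.
have [_ lA] := (continuous_onP T0 A).1 cA.
have : A @ t^'- --> A t by apply: lA; rewrite t0.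
move=> /cvg_at_leftP; apply; split => //.
Unshelve. all: by end_near. Qed.

Lemma stieltjes_charge_co A a b : continuous_bv T A -> 0 <= a -> a <= b -> b <= T ->
  nu A `[a, b[%classic = (A b - A a)%:E.
Proof.
move=> iv a0 ab bT.
have cb := stieltjes_charge_0co iv (introT andP (conj (le_trans a0 ab) bT)).
have ca := stieltjes_charge_0co iv (introT andP (conj a0 (le_trans ab bT))).
apply: charge_diff cb ca _ _ => //.
  by apply: subset_itvl; rewrite bnd_simp.
apply/seteqP; split => t /=; rewrite !in_itv/=.
  move=> /andP[at_ tb]; rewrite tb (le_trans a0 at_); split => //.
  by apply/negP; rewrite negb_and -leNgt at_ orbT.
by move=> [/andP[-> ->] /negP]; rewrite andbT -leNgt.
Qed.

Lemma stieltjes_charge_setT A : continuous_bv T A -> nu A [set T] = 0%E.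
Proof.
move=> cA; have iA := continuous_bv_integrator cA.
have TT : 0 <= T <= T by rewrite lexx ltW.
have := charge_diff (_ : measurable `[0, T]%classic) (_ : measurable `[0, T[%classic)
  (stieltjes_charge_cc iA TT) (stieltjes_charge_0co cA TT) _ _.
rewrite subrr; apply => //; first by apply: subset_itvl; rewrite bnd_simp.
apply/seteqP; split => t /=; rewrite !in_itv/=.
  by move=> ->; rewrite ltW// lexx; split => //; rewrite ltxx andbF.
move=> [/andP[-> tT] /negP]; rewrite -leNgt => Tt.
by apply/eqP; rewrite eq_le tT.
Qed.

Local Notation I := (stieltjes_integral T).
Local Notation D := (`[0, T]%classic : set (measurableTypeR R)).

Lemma stieltjes_integralD f g v : bounded_measurable D f -> bounded_measurable D g ->
  I (f \+ g) v = I f v + I g v.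
Proof. by move=> bf bg; rewrite /stieltjes_integral charge_integralD. Qed.

Lemma stieltjes_integralZ c f v : bounded_measurable D f ->
  I (fun t => c * f t) v = c * I f v.
Proof. by move=> bf; rewrite /stieltjes_integral charge_integralZ. Qed.

Lemma stieltjes_integralB f g v : bounded_measurable D f -> bounded_measurable D g ->
  I (f \- g) v = I f v - I g v.
Proof.
move=> bf bg.
rewrite -[- I g v]mulN1r -stieltjes_integralZ// -stieltjes_integralD//.
  by congr (I _ v); apply/funext => t /=; rewrite mulN1r.
exact: bounded_measurableZ.
Qed.

Lemma stieltjes_integral_indic B v : measurable B -> B `<=` D ->
  I \1_B v = fine (nu v B).
Proof. by move=> mB BD; rewrite /stieltjes_integral charge_integral_indic. Qed.

Lemma stieltjes_integral_bound v : exists2 C, 0 <= C &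
  forall f M, bounded_measurable D f -> (forall t, 0 <= t <= T -> `|f t| <= M) ->
    `|I f v| <= C * M.
Proof.
have [|C C0 CP] := @charge_integral_bound _ (nu v) D; first by [].
by exists C => // f M [mf _] fM; apply: CP => // t; rewrite /= in_itv/= => /fM.
Qed.

Lemma stieltjes_integral_rstep f A a s : continuous_bv T A -> mesh ltmesh a s ->
  0 <= a -> last a s = T -> I (rstep f a s) A = rsum f A a s.
Proof.
move=> cA; elim: s a => [a _ _ _|b s IHs a [ab ms] a0 ls] /=.
  rewrite -[RHS](mul0r (I (rstep f a [::]) A)) -stieltjes_integralZ.
    by congr (I _ A); apply/funext => t /=; rewrite mulr0.
  exact: bounded_measurable_rstep.
have bT : b <= T by rewrite -ls; exact: mesh_lt_last.
rewrite stieltjes_integralD.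
- rewrite IHs ?(le_trans a0 (ltW ab))// stieltjes_integralZ.
    rewrite stieltjes_integral_indic ?stieltjes_charge_co ?(ltW ab)//.
    by apply: subset_itv; rewrite bnd_simp.
  exact: bounded_measurable_indic.
- by apply: bounded_measurableZ; exact: bounded_measurable_indic.
- exact: bounded_measurable_rstep.
Qed.

Lemma stieltjes_integral_lstep f v a s : integrator v -> mesh ltmesh a s ->
  0 <= a -> last a s = T -> I (lstep f a s) v = lsum f v a s.
Proof.
move=> cA; elim: s a => [a _ _ _|b s IHs a [ab ms] a0 ls] /=.
  rewrite -[RHS](mul0r (I (lstep f a [::]) v)) -stieltjes_integralZ.
    by congr (I _ v); apply/funext => t /=; rewrite mulr0.
  exact: bounded_measurable_lstep.
have bT : b <= T by rewrite -ls; exact: mesh_lt_last.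
rewrite stieltjes_integralD.
- rewrite IHs ?(le_trans a0 (ltW ab))// stieltjes_integralZ.
    rewrite stieltjes_integral_indic ?stieltjes_charge_oc ?(ltW ab)//.
    by apply: subset_itv; rewrite bnd_simp.
  exact: bounded_measurable_indic.
- by apply: bounded_measurableZ; exact: bounded_measurable_indic.
- exact: bounded_measurable_lstep.
Qed.

Lemma rsum_approx A : continuous_bv T A -> exists2 C, 0 <= C &
  forall x d s, cadlag_on T x -> 0 <= d -> mesh (rmesh x d) 0 s -> last 0 s = T ->
    `|I x A - rsum x A 0 s| <= C * d.
Proof.
move=> cA; have [C C0 CP] := stieltjes_integral_bound A; exists C => // x d s cx d0 ms ls.
have ms' : mesh ltmesh 0 s by apply: mesh_sub ms => ? ? [].
have bx := cadlag_bounded_measurable T0 cx.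
have br := bounded_measurable_rstep D x 0 s.
have bT : bounded_measurable D (fun t => x T * \1_[set T] t).
  by apply: bounded_measurableZ; exact: bounded_measurable_indic.
(* The step function is completed at [T] so as to be close to [x] on all of [0, T]; the added term
   has integral 0 because [T] is not an atom. *)
have -> : rsum x A 0 s = I (rstep x 0 s \+ (fun t => x T * \1_[set T] t)) A.
  rewrite stieltjes_integralD// stieltjes_integral_rstep// stieltjes_integralZ//.
    rewrite stieltjes_integral_indic ?stieltjes_charge_setT ?mulr0 ?addr0//.
    by move=> t ->; rewrite /= in_itv/= lexx ltW.
  exact: bounded_measurable_indic.
rewrite -stieltjes_integralB//; last exact: bounded_measurableD.
apply: CP => [|t tT]; last exact: point_rstep_approx.
by apply: bounded_measurableB => //; exact: bounded_measurableD.
Qed.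

(** The cells ]a, b] do not cover 0, where the charge has the atom [v 0]; hence the term
    [f 0 * v 0]. *)
Lemma lsum_approx v : integrator v -> exists2 C, 0 <= C &
  forall f d s, continuous_on T f -> 0 <= d -> mesh (lmesh f d) 0 s -> last 0 s = T ->
    `|I f v - (f 0 * v 0 + lsum f v 0 s)| <= C * d.
Proof.
move=> iv; have [C C0 CP] := stieltjes_integral_bound v; exists C => // f d s cf d0 ms ls.
have ms' : mesh ltmesh 0 s by apply: mesh_sub ms => ? ? [].
have bf := cadlag_bounded_measurable T0 (continuous_on_cadlag_on cf).
have br := bounded_measurable_lstep D f 0 s.
have b0 : bounded_measurable D (fun t => f 0 * \1_[set 0] t).
  by apply: bounded_measurableZ; exact: bounded_measurable_indic.
have -> : f 0 * v 0 + lsum f v 0 s = I ((fun t => f 0 * \1_[set 0] t) \+ lstep f 0 s) v.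
  rewrite stieltjes_integralD// stieltjes_integral_lstep// stieltjes_integralZ//.
    rewrite stieltjes_integral_indic ?stieltjes_charge_set1//.
    by move=> t ->; rewrite /= in_itv/= lexx ltW.
  exact: bounded_measurable_indic.
rewrite -stieltjes_integralB//; last exact: bounded_measurableD.
apply: CP => [|t].
  by apply: bounded_measurableB => //; exact: bounded_measurableD.
rewrite le_eqVlt => /andP[/predU1P[<- _|t0 tT]] /=.
  by rewrite lstep0// indicE mem_set// mulr1 addr0 subrr normr0.
rewrite indicE memNset/=; last by move=> t0'; rewrite t0' ltxx in t0.
by rewrite mulr0 add0r lstep_approx// t0 ls.
Qed.

End stieltjes.

(** * Linearity in the integrator, integration by parts, jump functions *)

Section integrator_space.
Context {R : realType}.
Variable T : R.
Hypothesis T0 : 0 < T.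
Implicit Types (f v w x A : R -> R).

Lemma tvnormD v w : (tvnorm T (v \+ w)%R <= tvnorm T v + tvnorm T w)%E.
Proof.
rewrite /tvnorm addeACA leeD//; first by rewrite -EFinD lee_fin ler_normD.
exact: (total_variation_le _ _ (ltW T0)).
Qed.

Lemma tvnorm_ge0 v : (0 <= tvnorm T v)%E.
Proof. by apply: adde_ge0; rewrite ?lee_fin// total_variation_ge0// ltW. Qed.

Lemma tvnormZ c v : (tvnorm T (fun t => c * v t)%R <= `|c|%:E * tvnorm T v)%E.
Proof.
rewrite /tvnorm ge0_muleDr ?lee_fin// ?total_variation_ge0 ?(ltW T0)//.
rewrite normrM EFinM leeD2l//; apply: ge_ereal_sup => _ [_ [s ps <-] <-].
have -> : variation 0 T (fun t => c * v t) s = `|c| * variation 0 T v s.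
  rewrite /variation mulr_sumr; apply: eq_bigr => i _ /=.
  by rewrite -mulrBr normrM.
rewrite EFinM lee_wpmul2l ?lee_fin//; apply: ereal_sup_ubound => /=.
by exists (variation 0 T v s) => //; exists s.
Qed.

Lemma tvnorm_nondecreasing v : {in `[0, T] &, nondecreasing_fun v} ->
  tvnorm T v = (`|v 0| + (v T - v 0))%:E.
Proof. by move=> nv; rewrite /tvnorm nondecreasing_total_variation// ltW. Qed.

Lemma integratorD v w : integrator T v -> integrator T w -> integrator T (v \+ w).
Proof.
move=> [rv tv] [rw tw]; split.
  by move=> t tT; apply: cvgD; [exact: rv|exact: rw].
by apply: le_lt_trans (tvnormD v w) _; rewrite lte_add_pinfty.
Qed.

Lemma integratorZ c v : integrator T v -> integrator T (fun t => c * v t).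
Proof.
move=> [rv tv]; split.
  by move=> t tT; apply: cvgM; [exact: cvg_cst|exact: rv].
by apply: le_lt_trans (tvnormZ c v) _; rewrite lte_mul_pinfty ?lee_fin.
Qed.

Lemma continuous_bvD v w : continuous_bv T v -> continuous_bv T w ->
  continuous_bv T (v \+ w).
Proof.
move=> [cv tv v0] [cw tw w0]; split; last by rewrite /= v0 w0 addr0.
  by move=> t; apply: cvgD; [exact: cv|exact: cw].
by apply: le_lt_trans (tvnormD v w) _; rewrite lte_add_pinfty.
Qed.

Lemma continuous_bvZ c v : continuous_bv T v ->
  continuous_bv T (fun t => c * v t).
Proof.
move=> [cv tv v0]; split; last by rewrite v0 mulr0.
  by move=> t; apply: cvgM; [exact: cvg_cst|exact: cv].
by apply: le_lt_trans (tvnormZ c v) _; rewrite lte_mul_pinfty ?lee_fin.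
Qed.

Lemma continuous_bv0 : continuous_bv T (fun=> 0 : R).
Proof.
split => //; first by move=> t; exact: cvg_cst.
by rewrite tvnorm_nondecreasing// ltry.
Qed.

Local Notation I := (stieltjes_integral T).

(** The three charges are chosen separately and their Jordan decompositions do not add up in
    general. All three integrals are compared with sums on a common mesh, and these are linear in
    the integrator. *)
Lemma integral_continuous_bvD x A B : cadlag_on T x ->
  continuous_bv T A -> continuous_bv T B -> I x (A \+ B) = I x A + I x B.
Proof.
move=> cx cA cB.
have [C C0 CP] := rsum_approx T0 cA.
have [C' C'0 C'P] := rsum_approx T0 cB.
have [C2 C20 C2P] := rsum_approx T0 (continuous_bvD cA cB).
apply: (@eq_of_le_scale _ _ _ (C2 + (C + C'))); first by rewrite !addr_ge0.
move=> d d0; have [s ms ls] := cadlag_rmesh T0 d0 cx.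
have h1 := CP _ _ _ cx (ltW d0) ms ls.
have h2 := C'P _ _ _ cx (ltW d0) ms ls.
have := C2P _ _ _ cx (ltW d0) ms ls; rewrite rsumDr => h3.
by rewrite 2!mulrDl; exact: dist_add_le h3 h1 h2.
Qed.

Lemma integral_continuous_bvZ x c A : cadlag_on T x ->
  continuous_bv T A -> I x (fun t => c * A t) = c * I x A.
Proof.
move=> cx cA.
have [C C0 CP] := rsum_approx T0 cA.
have [C' C'0 C'P] := rsum_approx T0 (continuous_bvZ c cA).
apply: (@eq_of_le_scale _ _ _ (C' + `|c| * C)); first by rewrite addr_ge0 ?mulr_ge0.
move=> d d0; have [s ms ls] := cadlag_rmesh T0 d0 cx.
have h1 := CP _ _ _ cx (ltW d0) ms ls.
have := C'P _ _ _ cx (ltW d0) ms ls; rewrite rsumZr => h2.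
by rewrite mulrDl -mulrA; exact: dist_scale_le h2 h1.
Qed.

(** Going through sums replaces the mass of the chosen charge by the variation of [A], which is
    bounded along tau-convergent integrators. *)
Lemma integral_continuous_bv_bound x A M : cadlag_on T x -> continuous_bv T A ->
  (forall t, 0 <= t < T -> `|x t| <= M) -> `|I x A| <= M * fine (tvnorm T A).
Proof.
move=> cx cA xM; have [C C0 CP] := rsum_approx T0 cA.
have M0 : 0 <= M by apply: le_trans (xM 0 _); rewrite ?lexx.
(* The tolerance [e / (C + 1)] keeps the error [C * d] below [e]; the summand 1 covers [C = 0]. *)
apply/ler_addgt0Pr => e e0; have C1 : 0 < C + 1 by rewrite ltr_wpDl.
have d0 := divr_gt0 e0 C1.
have [s ms ls] := cadlag_rmesh T0 d0 cx.
rewrite -[I x A](subrK (rsum x A 0 s)) addrC (le_trans (ler_normD _ _))//.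
apply: lerD; last first.
  apply: le_trans (CP _ _ _ cx (ltW d0) ms ls) _.
  by rewrite mulrCA ler_piMr ?(ltW e0)// ler_pdivrMr// mul1r lerDl.
have ms' : mesh ltmesh 0 s by apply: mesh_sub ms => ? ? [].
have := @rsum_total_variation _ x A M 0 s ms'; rewrite ls => /(_ xM).
have [_ tA A0] := cA.
have fA : tvnorm T A \is a fin_num by rewrite ge0_fin_numE// tvnorm_ge0.
by move: fA; rewrite /tvnorm A0 normr0 add0e => /fineK {1}<-; rewrite -EFinM lee_fin.
Qed.

(** One mesh serves both integrals, and [rsum_by_parts] links their sums. [A 0 = 0] removes the
    boundary term at 0 and the contribution of the atom of [v]. *)
Lemma integral_by_parts v A : cadlag_on T v -> integrator T v -> continuous_bv T A ->
  I v A = v T * A T - I A v.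
Proof.
move=> cv iv cA; have [C C0 CP] := rsum_approx T0 cA.
have [C' C'0 C'P] := lsum_approx T0 iv.
have [/(continuous_onP T0) cA' _ A0] := cA.
apply: (@eq_of_le_scale _ _ _ (C + C')); first by rewrite addr_ge0.
move=> d d0; have [s [ms ms' ls]] := cadlag_continuous_mesh T0 d0 cv cA'.
have := CP _ _ _ cv (ltW d0) ms ls; rewrite rsum_by_parts ls A0 mulr0 subr0 => h1.
have := C'P _ _ _ cA' (ltW d0) ms' ls; rewrite A0 mul0r add0r => h2.
by rewrite mulrDl; exact: dist_sub_le h1 h2.
Qed.

Lemma integral_integratorD f v w : continuous_on T f ->
  integrator T v -> integrator T w -> I f (v \+ w) = I f v + I f w.
Proof.
move=> cf iv iw.
have [C C0 CP] := lsum_approx T0 iv.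
have [C' C'0 C'P] := lsum_approx T0 iw.
have [C2 C20 C2P] := lsum_approx T0 (integratorD iv iw).
apply: (@eq_of_le_scale _ _ _ (C2 + (C + C'))); first by rewrite !addr_ge0.
move=> d d0.
have [s [_ ms ls]] := cadlag_continuous_mesh T0 d0 (continuous_on_cadlag_on cf) cf.
have h1 := CP _ _ _ cf (ltW d0) ms ls.
have h2 := C'P _ _ _ cf (ltW d0) ms ls.
have := C2P _ _ _ cf (ltW d0) ms ls; rewrite lsumDr /= mulrDr addrACA => h3.
by rewrite 2!mulrDl; exact: dist_add_le h3 h1 h2.
Qed.

Lemma integral_integratorZ f c v : continuous_on T f -> integrator T v ->
  I f (fun t => c * v t) = c * I f v.
Proof.
move=> cf iv; have [C C0 CP] := lsum_approx T0 iv.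
have [C' C'0 C'P] := lsum_approx T0 (integratorZ c iv).
apply: (@eq_of_le_scale _ _ _ (C' + `|c| * C)); first by rewrite addr_ge0 ?mulr_ge0.
move=> d d0.
have [s [_ ms ls]] := cadlag_continuous_mesh T0 d0 (continuous_on_cadlag_on cf) cf.
have h1 := CP _ _ _ cf (ltW d0) ms ls.
have := C'P _ _ _ cf (ltW d0) ms ls; rewrite lsumZr mulrCA -mulrDr => h2.
by rewrite mulrDl -mulrA; exact: dist_scale_le h2 h1.
Qed.

Lemma cadlag_on_jump s : 0 <= s <= T -> cadlag_on T \1_(`[s, T]%classic).
Proof.
move=> /andP[s0 sT]; split => t /andP[t0 tT].
  have [ts|st] := ltP t s.
    rewrite indicE memNset; last by rewrite /= in_itv/= leNgt ts.
    apply: cvg_near_cst; near=> u; rewrite indicE memNset//= in_itv/=.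
    by apply/negP; rewrite negb_and -ltNge; apply/orP; left; near: u; exact: nbhs_right_lt.
  rewrite indicE mem_set; last by rewrite /= in_itv/= st ltW.
  apply: cvg_near_cst; near=> u; rewrite indicE mem_set//= in_itv/=.
  apply/andP; split; last by near: u; exact: nbhs_right_le.
  by apply: (le_trans st); near: u; exact: nbhs_right_ge.
have [st|ts] := ltP s t.
  apply/cvg_ex; exists 1; apply: cvg_near_cst; near=> u; rewrite indicE mem_set//= in_itv/=.
  apply/andP; split; first by near: u; exact: nbhs_left_ge.
  by apply: le_trans tT; near: u; exact: nbhs_left_le.
apply/cvg_ex; exists 0; apply: cvg_near_cst; near=> u; rewrite indicE memNset//= in_itv/=.
apply/negP; rewrite negb_and -ltNge; apply/orP; left; apply: lt_le_trans ts.
by near: u; exact: nbhs_left_lt.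
Unshelve. all: by end_near. Qed.

Lemma integrator_jump s : 0 <= s <= T -> integrator T \1_(`[s, T]%classic).
Proof.
move=> sT; split; first by case: (cadlag_on_jump sT).
rewrite tvnorm_nondecreasing ?ltry// => a b; rewrite !in_itv/= => /andP[_ aT] /andP[_ bT] ab.
rewrite !indicE ler_nat; have [sa|] := boolP (a \in _) => //.
rewrite mem_set//; move/set_mem : sa; rewrite /= !in_itv/= => /andP[sa _].
by rewrite bT (le_trans sa).
Qed.

(** The integrator increases only over the cell ]a, b] that contains [s], so the sum evaluates the
    step function at [s]. *)
Lemma lsum_jump f a s l : mesh ltmesh a l -> last a l <= T ->
  lsum f \1_(`[s, T]%classic) a l = lstep f a l s.
Proof.
elim: l a => //= b l IHl a [ab ml] lT; rewrite IHl//; congr (f b * _ + _).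
have bT : b <= T := le_trans (mesh_lt_last ml) lT.
have aT := le_trans (ltW ab) bT.
rewrite !indicE !mem_setE !in_itv/= aT bT !andbT.
have [sb|bs] := leP s b; last by rewrite leNgt (lt_trans ab bs) andbF subrr.
by rewrite andbT; case: (leP s a) => _ /=; rewrite ?subr0 ?subrr.
Qed.

Lemma integral_jump f s : continuous_on T f -> 0 <= s <= T ->
  I f \1_(`[s, T]%classic) = f s.
Proof.
move=> cf sT; have [C C0 CP] := lsum_approx T0 (integrator_jump sT).
apply: (@eq_of_le_scale _ _ _ (C + 1)); first by rewrite addr_ge0.
move=> d d0.
have [l [_ ml ll]] := cadlag_continuous_mesh T0 d0 (continuous_on_cadlag_on cf) cf.
have := CP _ _ _ cf (ltW d0) ml ll.
have ml' : mesh ltmesh 0 l by apply: mesh_sub ml => ? ? [].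
rewrite lsum_jump ?ll//.
set w := f 0 * _ + _ => h.
rewrite (_ : _ - _ = (I f \1_(`[s, T]%classic) - w) + (w - f s)); last by ring.
apply: le_trans (ler_normD _ _) _; rewrite mulrDl mul1r; apply: lerD => //.
rewrite {h}/w.
(* For [s = 0] the unit mass is the atom at 0, and no cell contains it. *)
case/andP : sT; rewrite le_eqVlt => /predU1P[<- _|s0 sT].
  rewrite lstep0// indicE mem_set/=; first by rewrite mulr1 addr0 subrr normr0 ltW.
  by rewrite in_itv/= lexx ltW.
rewrite indicE memNset/=; last by rewrite in_itv/= leNgt s0.
by rewrite mulr0 add0r distrC lstep_approx// ?ll ?s0.
Qed.

(** Pairs of a height and a time. Times may coincide and come in any order, so that limits of jump
    data are again jump data. *)
Definition jumps (l : seq (R * R)) t : R :=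
  \sum_(p <- l) p.1 * \1_(`[p.2, T]%classic) t.

Definition jump_times (l : seq (R * R)) := all (fun p => 0 <= p.2 <= T) l.

Lemma jumps_cons p l : jumps (p :: l) = (fun t => p.1 * \1_(`[p.2, T]%classic) t) \+ jumps l.
Proof. by apply/funext => t; rewrite /jumps big_cons. Qed.

Lemma cadlag_on_jumps l : jump_times l -> cadlag_on T (jumps l).
Proof.
elim: l => [_|p l IHl /= /andP[pT lT]].
  apply: continuous_on_cadlag_on; split=> t tT.
    by rewrite /jumps big_nil; apply: cvg_near_cst; near=> u; rewrite big_nil.
  by rewrite /jumps big_nil; apply: cvg_near_cst; near=> u; rewrite big_nil.
rewrite jumps_cons; apply: cadlag_onD; last exact: IHl.
by apply: cadlag_onZ; exact: cadlag_on_jump.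
Unshelve. all: by end_near. Qed.

Lemma integrator_jumps l : jump_times l -> integrator T (jumps l).
Proof.
elim: l => [_|p l IHl /= /andP[pT lT]].
  rewrite (_ : jumps [::] = (fun=> 0)).
    exact: continuous_bv_integrator continuous_bv0.
  by apply/funext => t; rewrite /jumps big_nil.
rewrite jumps_cons; apply: integratorD; last exact: IHl.
by apply: integratorZ; exact: integrator_jump.
Qed.

Lemma integral_jumps f l : continuous_on T f -> jump_times l ->
  I f (jumps l) = \sum_(p <- l) p.1 * f p.2.
Proof.
move=> cf; elim: l => [_|p l IHl /= /andP[pT lT]].
  have i0 : integrator T (fun=> 0) by exact: continuous_bv_integrator continuous_bv0.
  rewrite big_nil; transitivity (0 * I f (fun=> 0)); last exact: mul0r.
  rewrite -(integral_integratorZ 0 cf i0); congr (I f _).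
  by apply/funext => t; rewrite /jumps big_nil mul0r.
rewrite jumps_cons integral_integratorD//.
- rewrite big_cons IHl//; congr (_ + _).
  by rewrite integral_integratorZ ?integral_jump//; exact: integrator_jump.
- by apply: integratorZ; exact: integrator_jump.
- exact: integrator_jumps.
Qed.

End integrator_space.

(** * Uniform limits and the gliding hump *)

Lemma cvg_uniform_approx {R : realType} (F : set_system R) {FF : Filter F}
    (f : R -> R) (t : R) :
  (forall e, 0 < e -> exists g : R -> R, [/\ g @ F --> g t, `|f t - g t| <= e &
    \forall u \near F, `|f u - g u| <= e]) ->
  f @ F --> f t.
Proof.
move=> h; apply/cvgrPdist_le => e e0.
have e30 : 0 < e / 3 by rewrite divr_gt0.
have [g [/cvgrPdist_le/(_ _ e30) gt ft fu]] := h _ e30.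
near=> u.
rewrite (_ : _ - _ = (f t - g t) + (g t - g u) - (f u - g u)); last by ring.
have -> : e = e / 3 + e / 3 + e / 3 by field.
apply: le_trans (ler_normB _ _) _; apply: lerD; last by near: u.
apply: le_trans (ler_normD _ _) _; apply: lerD => //; near: u; exact: gt.
Unshelve. all: by end_near. Qed.

Section uniform_limits.
Context {R : realType}.
Variable T : R.

Lemma continuous_on_uniform_limit (f : R -> R) :
  (forall e, 0 < e -> exists2 g, continuous_on T g &
    forall t, 0 <= t <= T -> `|f t - g t| <= e) ->
  continuous_on T f.
Proof.
move=> h; split=> t /andP[t0 tT]; apply: cvg_uniform_approx => e /h[g [gr gl] fg].
  exists g; split; [by apply: gr; rewrite t0|by rewrite fg// t0 ltW|].
  near=> u; apply: fg; apply/andP; split.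
    by apply: (le_trans t0); near: u; exact: nbhs_right_ge.
  by near: u; exact: nbhs_right_le.
exists g; split; [by apply: gl; rewrite t0|by rewrite fg// tT ltW|].
near=> u; apply: fg; apply/andP; split.
  by near: u; exact: nbhs_left_ge.
by apply: le_trans tT; near: u; exact: nbhs_left_le.
Unshelve. all: by end_near. Qed.

Lemma continuous_onD (f g : R -> R) : continuous_on T f -> continuous_on T g ->
  continuous_on T (f \+ g).
Proof.
move=> [fr fl] [gr gl]; split=> t tT.
  by apply: cvgD; [exact: fr|exact: gr].
by apply: cvgD; [exact: fl|exact: gl].
Qed.

Lemma continuous_onB (f g : R -> R) : continuous_on T f -> continuous_on T g ->
  continuous_on T (f \- g).
Proof.
move=> [fr fl] [gr gl]; split=> t tT.
  by apply: cvgB; [exact: fr|exact: gr].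
by apply: cvgB; [exact: fl|exact: gl].
Qed.

(** The limit is the supremum of the lower ends of the intervals of radius [r k] about [S k t]:
    every lower end lies below every upper end. *)
Lemma nested_balls_limit (S : nat -> R -> R) (r : nat -> R) :
  (forall k, 0 <= r k) ->
  (forall t k m, 0 <= t <= T -> (k <= m)%N -> `|S m t - S k t| <= r k) ->
  exists f : R -> R, forall t k, 0 <= t <= T -> `|f t - S k t| <= r k.
Proof.
move=> r0 Sr; exists (fun t => sup (range (fun k => S k t - r k))) => t k tT.
have ub j : S j t - r j <= S k t + r k.
  have rj := r0 j; have rk := r0 k.
  have [kj|jk] := leqP k j.
    by have := Sr t k j tT kj; rewrite ler_norml => /andP[]; lra.
  by have := Sr t j k tT (ltnW jk); rewrite ler_norml => /andP[]; lra.
rewrite ler_norml; apply/andP; split; last first.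
  rewrite lerBlDr addrC; apply: ge_sup; first by exists (S 0%N t - r 0%N), 0%N.
  by move=> _ [j _ <-].
rewrite lerBrDr addrC; apply: ub_le_sup; last by exists k.
by exists (S k t + r k) => _ [j _ <-].
Qed.

End uniform_limits.

Section tau.
Context {R : realType}.
Variable T : R.
Hypothesis T0 : 0 < T.

Lemma supnorm_leP (f : R -> R) e :
  (supnorm T f <= e%:E)%E <-> forall t, 0 <= t <= T -> `|f t| <= e.
Proof.
split=> [fe t tT|fe].
  rewrite -lee_fin; apply: le_trans fe; apply: ereal_sup_ubound => /=.
  by exists t => //=; rewrite in_itv.
by apply: ge_ereal_sup => _ [t /= + <-]; rewrite in_itv/= lee_fin; exact: fe.
Qed.

Lemma supnorm_ge0 (f : R -> R) : (0 <= supnorm T f)%E.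
Proof.
apply: (@le_trans _ _ (`|f 0|%:E)); first by rewrite lee_fin.
by apply: ereal_sup_ubound; exists 0 => //=; rewrite in_itv/= lexx ltW.
Qed.

Lemma tau_cvgP (A : nat -> R -> R) (A0 : R -> R) : tau_cvg T A A0 <->
  (forall e, 0 < e -> \forall n \near \oo, forall t, 0 <= t <= T -> `|A n t - A0 t| <= e) /\
  exists C, forall n, (tvnorm T (A n) <= C%:E)%E.
Proof.
split=> [[s0 tv]|[s0 [C tv]]]; split.
- move=> e e0; move/fine_cvgP : s0 => [fs /cvgrPdist_le/(_ _ e0)].
  apply: filterS2 fs => n fs; rewrite sub0r normrN ger0_norm ?fine_ge0 ?supnorm_ge0//.
  by rewrite -lee_fin fineK// => /supnorm_leP.
- exists (fine (ereal_sup (range (fun n => tvnorm T (A n))))) => n.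
  have h : (tvnorm T (A n) <= ereal_sup (range (fun n => tvnorm T (A n))))%E.
    by apply: ereal_sup_ubound; exists n.
  rewrite fineK// ge0_fin_numE//; exact: le_trans (tvnorm_ge0 T0 _) h.
- apply/fine_cvgP; split.
    have := s0 _ ltr01; apply: filterS => n /(supnorm_leP (A n \- A0)) h.
    by rewrite ge0_fin_numE ?supnorm_ge0// (le_lt_trans h)// ltry.
  apply/cvgrPdist_le => e e0.
  have := s0 _ e0; apply: filterS => n /(supnorm_leP (A n \- A0)) h.
  rewrite sub0r normrN ger0_norm ?fine_ge0 ?supnorm_ge0//.
  rewrite -lee_fin fineK// ge0_fin_numE ?supnorm_ge0//.
  by rewrite (le_lt_trans h)// ltry.
- apply: (@le_lt_trans _ _ C%:E); last exact: ltry.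
  by apply: ge_ereal_sup => _ [n _ <-].
Qed.

End tau.

Section gliding_hump.
Context {R : realType}.
Variable T : R.
Hypothesis T0 : 0 < T.
Variable L : nat -> (R -> R) -> R.
Hypothesis LD : forall n f g, continuous_on T f -> continuous_on T g ->
  L n (f \+ g) = L n f + L n g.
Hypothesis Lbound : forall n, exists2 C, 0 <= C & forall f M, continuous_on T f ->
  (forall t, 0 <= t <= T -> `|f t| <= M) -> `|L n f| <= C * M.
Hypothesis L0 : forall f, continuous_on T f -> L n f @[n --> \oo] --> 0.

(* If [|L n (h n)| >= e] infinitely often, choose [n_1 < n_2 < ...] among those
   indices so that the limit [f] of [S_k := h n_1 + ... + h n_k] exists
   uniformly; [L n_k] is small at [S_{k-1}] by [L0] and at [f - S_k] because
   the later humps are chosen small with respect to the norm of [L n_k]. So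
   [L n_k f] stays away from [0]. *)
Lemma gliding_hump (h : nat -> R -> R) :
  (forall n, continuous_on T (h n)) ->
  (forall e, 0 < e -> \forall n \near \oo, forall t, 0 <= t <= T -> `|h n t| <= e) ->
  L n (h n) @[n --> \oo] --> 0.
Proof.
move=> ch h0; apply: contrapT => nL.
have [e e0 frq] : exists2 e, 0 < e & forall N, exists n, (N <= n)%N /\ e <= `|L n (h n)|.
  apply: contrapT => H; apply: nL; apply/cvgrPdist_lt => e e0; apply: contrapT => H'.
  apply: H; exists e => // N; apply: contrapT => H''; apply: H'; exists N => // n /= Nn.
  by rewrite sub0r normrN ltNge; apply/negP => eL; apply: H''; exists n.
have e40 : 0 < e / 4 by rewrite divr_gt0.
(* The last index chosen, the partial sum of the humps, and a bound for all that is still to be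
   added. *)
pose state := (nat * (R -> R) * R)%type.
pose good (p : state) := continuous_on T p.1.2 /\ 0 < p.2.
pose next (p q : state) := [/\ (p.1.1 < q.1.1)%N,
   q.1.2 = p.1.2 \+ h q.1.1, q.2 <= p.2 / 2 &
   (forall t, 0 <= t <= T -> `|h q.1.1 t| <= p.2 / 2) /\
   [/\ e <= `|L q.1.1 (h q.1.1)|, `|L q.1.1 p.1.2| <= e / 4 &
   forall f, continuous_on T f -> (forall t, 0 <= t <= T -> `|f t| <= q.2) ->
     `|L q.1.1 f| <= e / 4]].
have nextP (p : state) : exists q, good p -> good q /\ next p q.
  have [gp|ngp] := pselect (good p); last by exists p.
  case: gp => cp p0; have p20 : 0 < p.2 / 2 by rewrite divr_gt0.
  have [N1 _ N1P] := h0 _ p20.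
  have /cvgrPdist_le/(_ _ e40)[N2 _ N2P] := L0 cp.
  have [n [nN en]] := frq (maxn p.1.1.+1 (maxn N1 N2)).
  move: nN; rewrite !geq_max => /and3P[pn nN1 nN2].
  have [C C0 CP] := Lbound n.
  have C1 : 0 < C + 1 by rewrite ltr_wpDl.
  (* Halving the radius makes the later humps sum to at most the radius; the second bound makes
     [L n] at most [e / 4] on functions of that size. *)
  exists (n, p.1.2 \+ h n, Num.min (p.2 / 2) (e / 4 / (C + 1))) => _; split.
    by split => /=; [exact: continuous_onD|rewrite lt_min p20 divr_gt0].
  split => //=; first by rewrite ge_min lexx.
  split; first exact: N1P.
  split => //; first by have := N2P n nN2; rewrite /= sub0r normrN.
  move=> f cf fM; apply: le_trans (CP f _ cf fM) _.
  apply: (@le_trans _ _ (C * (e / 4 / (C + 1)))).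
    by rewrite ler_wpM2l// ge_min lexx orbT.
  by rewrite mulrCA ler_piMr ?(ltW e40)// ler_pdivrMr// mul1r lerDl.
have {nextP}[F FP] := choice nextP.
pose u k := iter k F (0%N, cst 0, 1).
have gu k : good (u k).
  elim: k => [|k /FP[]//]; split => //=.
  by split => t _; exact: cvg_cst.
have nu k : next (u k) (u k.+1) by case: (FP _ (gu k)).
pose S k := (u k).1.2; pose r k := (u k).2; pose n k := (u k).1.1.
have r0 k : 0 < r k by case: (gu k).
have rS k : r k.+1 <= r k / 2 by case: (nu k).
have SS k t : 0 <= t <= T -> `|S k.+1 t - S k t| <= r k / 2.
  case: (nu k) => _ SE _ [hk _] /hk; congr (_ <= _).
  by rewrite /S SE /=; congr `|_|; ring.
have Sr t k m : 0 <= t <= T -> (k <= m)%N -> `|S m t - S k t| <= r k.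
  move=> tT /subnKC <-; move: (m - k)%N => j; elim: j k => [|j IHj] k.
    by rewrite addn0 subrr normr0 ltW.
  rewrite addnS -addSn -(subrK (S k.+1 t) (S (k.+1 + j)%N t)) -addrA.
  apply: le_trans (ler_normD _ _) _; rewrite [leRHS]splitr.
  by apply: lerD; [exact: le_trans (IHj _) (rS _)|exact: SS].
have [f fS] := nested_balls_limit (fun k => ltW (r0 k)) Sr.
have rle k : r k <= k.+1%:R^-1.
  elim: k => [|k IHk]; first by rewrite /r /= invr1.
  apply: le_trans (rS k) _; apply: (@le_trans _ _ (k.+1%:R^-1 / 2)).
    by rewrite ler_wpM2r.
  rewrite -invfM lef_pV2 ?posrE ?mulr_gt0 ?ltr0n// -natrM ler_nat.
  by rewrite mulnC mul2n -addnn addSn ltnS leq_addl.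
have cS k : continuous_on T (S k) by case: (gu k).
have cf : continuous_on T f.
  apply: continuous_on_uniform_limit => d d0.
  have [k kd] : exists k, k.+1%:R^-1 < d.
    by have /filter_ex := near_infty_natSinv_lt (PosNum d0); apply.
  exists (S k) => // t tT; apply: le_trans (fS t k tT) _.
  exact: le_trans (rle k) (ltW kd).
have kn k : (k <= n k)%N.
  by elim: k => // k IHk; apply: leq_ltn_trans IHk _; case: (nu k).
(* Of the [e] contributed by the current hump, the earlier and the later humps take away at most
   [e / 4] each. *)
have big k : e / 2 <= `|L (n k.+1) f|.
  case: (nu k) => _ SE _ [_ [e1 e2 e3]].
  have -> : f = S k.+1 \+ (f \- S k.+1) by apply/funext => t /=; ring.
  rewrite LD//; last exact: continuous_onB.
  have {e3} := e3 _ (continuous_onB cf (cS k.+1)) (fun t => fS t k.+1).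
  have -> : L (n k.+1) (S k.+1) = L (n k.+1) (S k) + L (n k.+1) (h (n k.+1)).
    by rewrite -LD//; congr (L _ _).
  move: e1 e2; rewrite -!/(n _) -!/(S _).
  move: (L _ (h _)) (L _ (S k)) (L _ (f \- _)) => a b c.
  move=> e1 e2 e3'.
  have h1 : `|a| <= `|b + a + c| + (`|b| + `|c|).
    rewrite {1}(_ : a = (b + a + c) - (b + c)); last by ring.
    by apply: le_trans (ler_normB _ _) _; rewrite lerD2l ler_normD.
  by lra.
have e20 : 0 < e / 2 by rewrite divr_gt0.
have /cvgrPdist_lt/(_ _ e20)[N _ NP] := L0 cf.
have := NP (n N.+1) (leq_trans (leqnSn N) (kn N.+1)).
by rewrite /= sub0r normrN ltNge big.
Qed.

End gliding_hump.

(** * S-convergence implies convergence of the integrals *)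

Section jump_approximation.
Context {R : realType}.
Variable T : R.
Hypothesis T0 : 0 < T.
Implicit Types (x : R -> R) (y a b t d e : R) (s : seq R).

(** Greedy thinning: a point is retained when [x] has moved by more than [e] since the last retained
    point [y]. Retained points count oscillations, and discarding the others costs an error of at
    most [e]. *)
Fixpoint keep x e y s :=
  if s is b :: s' then
    if `|x b - x y| <= e then keep x e y s' else b :: keep x e b s'
  else [::].

Fixpoint increments x y s :=
  if s is b :: s' then (x b - x y, b) :: increments x b s' else [::].

Definition oscillation x e a b := a < b /\ e < `|x b - x a|.

Lemma size_increments x y s : size (increments x y s) = size s.
Proof. by elim: s y => //= b s IHs y; rewrite IHs. Qed.

Lemma jumps_increments0 x y s t : all (fun b => t < b) s ->
  jumps T (increments x y s) t = 0.
Proof.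
elim: s y => [|b s IHs] y /=; first by rewrite /jumps big_nil.
move=> /andP[tb /IHs{}IHs]; rewrite jumps_cons /= IHs addr0.
by rewrite indicE memNset ?mulr0//= in_itv/= leNgt tb.
Qed.

Lemma keep_gt x e y a s t : mesh ltmesh a s -> t <= a ->
  all (fun b => t < b) (keep x e y s).
Proof.
elim: s y a => //= b s IHs y a [ab ms] ta.
have tb := le_lt_trans ta ab.
by case: ifP => _ /=; rewrite ?tb (IHs _ b)// ltW.
Qed.

Lemma keep_oscillation x e y a s : mesh ltmesh a s -> y <= a ->
  mesh (oscillation x e) y (keep x e y s).
Proof.
elim: s y a => //= b s IHs y a [ab ms] ya; case: leP => [_|eb] /=.
  by apply: (IHs _ b) => //; exact: le_trans ya (ltW ab).
by split; [split => //; exact: le_lt_trans ab|exact: (IHs _ b)].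
Qed.

Lemma keep_le_last x e y a s : mesh ltmesh a s ->
  all (fun b => b <= last a s) (keep x e y s).
Proof.
elim: s y a => //= b s IHs y a [ab ms].
by case: ifP => _ /=; rewrite ?IHs ?mesh_lt_last.
Qed.

(** Here [y] is the last retained point and [a] the current mesh point. The error [e] comes from the
    thinning and [d] from the oscillation inside a cell. *)
Lemma keep_approx x d e y a s t : mesh (rmesh x d) a s -> last a s <= T ->
  0 <= d -> `|x a - x y| <= e -> a <= t <= last a s ->
  `|x t - (x y + jumps T (increments x y (keep x e y s)) t)| <= d + e.
Proof.
move=> + + d0; elim: s y a => [|b s IHs] y a /=.
  move=> _ _ ya /andP[a_t ta]; have -> : t = a by apply/eqP; rewrite eq_le ta.
  by rewrite /jumps big_nil addr0 (le_trans ya)// lerDr.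
move=> [[ab abd] ms] lT xay /andP[a_t tl].
have ms' : mesh ltmesh b s by apply: mesh_sub ms => ? ? [].
have [tb|bt] := ltP t b.
  rewrite jumps_increments0 ?addr0.
    rewrite -(subrK (x a) (x t)) -addrA (le_trans (ler_normD _ _))// lerD//.
    by rewrite abd// a_t.
  case: ifP => _ /=; first exact: keep_gt (ltW tb).
  by rewrite tb; exact: keep_gt (ltW tb).
case: ifPn => [xby|_]; first by apply: (IHs _ b); rewrite ?bt.
(* A retained [b] restores the exact value, [x y + (x b - x y) = x b], and the induction restarts
   there. *)
rewrite /= jumps_cons/= indicE mem_set/=; last by rewrite in_itv/= bt (le_trans tl).
rewrite mulr1 addrA (addrC (x y)) subrK.
apply: (IHs b b) => //; first by rewrite subrr normr0 (le_trans _ xay).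
by rewrite bt.
Qed.

(** The initial value is entered as a jump at time 0, in accordance with the atom of the charge at
    0. *)
Definition jump_list x e s := (x 0, 0) :: increments x 0 (keep x e 0 s).

Lemma jump_list_times x e s : mesh ltmesh 0 s -> last 0 s = T ->
  jump_times T (jump_list x e s).
Proof.
move=> ms ls; rewrite /jump_times/= lexx (ltW T0)/=.
have := keep_gt x e 0 ms (lexx 0).
have := keep_le_last x e 0 ms; rewrite ls.
suff h l y : all (fun b => b <= T) l -> all (fun b => 0 < b) l ->
    jump_times T (increments x y l) by exact: h.
elim: l y => //= b l IHl y /andP[bT lT] /andP[b0 l0].
by rewrite (ltW b0) bT IHl.
Qed.

Lemma jump_list_approx x d e s t : mesh (rmesh x d) 0 s -> last 0 s = T ->
  0 <= d -> 0 <= e -> 0 <= t <= T ->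
  `|x t - jumps T (jump_list x e s) t| <= d + e.
Proof.
move=> ms ls d0 e0 tT; rewrite jumps_cons/= indicE mem_set/= ?in_itv//= mulr1.
by apply: (keep_approx ms); rewrite ?ls// subrr normr0.
Qed.

Lemma jumps_out l t : jump_times T l -> t \notin `[0, T] -> jumps T l t = 0.
Proof.
move=> + tT; elim: l => [|p l IHl] /=; first by rewrite /jumps big_nil.
move=> /andP[/andP[p0 pT] /IHl{}IHl]; rewrite jumps_cons/= IHl addr0.
rewrite indicE memNset ?mulr0//= in_itv/= => /andP[pt tT'].
by move: tT; rewrite in_itv/= tT' (le_trans p0 pt).
Qed.

Definition jumps_cadlag l (lT : jump_times T l) : cadlag T :=
  Cadlag (cadlag_on_jumps lT).1 (cadlag_on_jumps lT).2 (fun t => jumps_out lT).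

Lemma jumps_cadlag_bv l (lT : jump_times T l) : bv_cadlag (jumps_cadlag lT).
Proof. by case: (integrator_jumps T0 lT). Qed.

(** Even for a constant sequence, S-convergence asks for uniform approximation by functions of
    bounded variation; jump functions provide it. *)
Lemma S_cvg_cst (x : cadlag T) : S_cvg (fun=> x) x.
Proof.
move=> e e0; have e20 : 0 < e / 2 by rewrite divr_gt0.
have [s ms ls] := cadlag_rmesh T0 e20 (cadlag_cadlag_on x).
have ms' : mesh ltmesh 0 s by apply: mesh_sub ms => ? ? [].
pose v := jumps_cadlag (jump_list_times x (e / 2) ms' ls).
have xv : (supnorm T (x \- v)%R <= e%:E)%E.
  apply/(supnorm_leP _ (_ \- _)) => t tT; rewrite [leRHS]splitr.
  exact: (jump_list_approx ms ls (ltW e20) (ltW e20) tT).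
exists (fun=> v), v; split => //; last by move=> f _; exact: cvg_cst.
by split=> [_|]; exact: jumps_cadlag_bv.
Qed.

End jump_approximation.

(** * Passage to the limit in the integrals, for S-convergence and then in the topology *)

Section direct.
Context {R : realType}.
Variable T : R.
Hypothesis T0 : 0 < T.
Local Notation I := (stieltjes_integral T).

Lemma bv_cadlag_integrator (v : cadlag T) : bv_cadlag v -> integrator T v.
Proof. by move=> tv; split => //; exact: cadlag_right. Qed.

Lemma integral_cst1 (v : R -> R) : integrator T v -> I (fun=> 1) v = v T.
Proof.
move=> iv; have -> : v T = fine (stieltjes_charge T v `[0, T]%classic).
  by rewrite stieltjes_charge_cc// lexx ltW.
rewrite -stieltjes_integral_indic//; apply: eq_charge_integral => t tT.
by rewrite indicE tT.
Qed.

Lemma weak_cvg_end (v : nat -> cadlag T) (v0 : cadlag T) :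
  (forall n, bv_cadlag (v n)) -> bv_cadlag v0 -> weak_cvg v v0 ->
  v n T @[n --> \oo] --> v0 T.
Proof.
move=> bv bv0 /(_ (fun=> 1)); rewrite integral_cst1; last exact: bv_cadlag_integrator.
rewrite (_ : (fun n => I _ _) = fun n => v n T); last first.
  by apply/funext => n; apply: integral_cst1; exact: bv_cadlag_integrator.
by apply => t; exact: cvg_cst.
Qed.

Lemma S_cvg_end (x : nat -> cadlag T) (x0 : cadlag T) :
  S_cvg x x0 -> x n T @[n --> \oo] --> x0 T.
Proof.
move=> xx0; apply/cvgrPdist_le => e e0; have e30 : 0 < e / 3 by rewrite divr_gt0.
have [v [v0 [[bv bv0] /(_ _)/supnorm_leP xv /supnorm_leP xv0 vv0]]] := xx0 _ e30.
have TT : 0 <= T <= T by rewrite lexx ltW.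
have /cvgrPdist_le/(_ _ e30) := weak_cvg_end bv bv0 vv0.
apply: filterS => n h; have := xv n _ TT; have := xv0 _ TT => /= h0 h1.
exact: dist_thirds h0 h h1.
Qed.

Lemma weak_cvg_tau (v : nat -> cadlag T) (v0 : cadlag T) A A0 :
  (forall n, bv_cadlag (v n)) -> bv_cadlag v0 -> weak_cvg v v0 ->
  (forall n, continuous_bv T (A n)) -> continuous_bv T A0 -> tau_cvg T A A0 ->
  I (v n) (A n) @[n --> \oo] --> I v0 A0.
Proof.
move=> bv bv0 vv0 cA cA0 /(tau_cvgP T0)[AA0 _].
have iv n := bv_cadlag_integrator (bv n); have iv0 := bv_cadlag_integrator bv0.
have con n : continuous_on T (A n) by case: (cA n) => /(continuous_onP T0).
have con0 : continuous_on T A0 by case: cA0 => /(continuous_onP T0).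
have TT : 0 <= T <= T by rewrite lexx ltW.
have bm f : continuous_on T f -> bounded_measurable `[0, T]%classic f.
  by move=> /continuous_on_cadlag_on /(cadlag_bounded_measurable T0).
rewrite (integral_by_parts T0 (cadlag_cadlag_on v0) iv0 cA0).
(* Subtracting the integral against [v0] yields functionals that tend to 0 at each continuous
   function, as the gliding hump requires. *)
rewrite (_ : (fun n => _) = fun n => v n T * A n T -
    (((I (A n \- A0) (v n) - I (A n \- A0) v0) + I (A n \- A0) v0) + I A0 (v n))); last first.
  apply/funext => n; rewrite (integral_by_parts T0 (cadlag_cadlag_on (v n)) (iv n) (cA n)).
  by rewrite subrK -stieltjes_integralD; [|exact/bm/continuous_onB|exact: bm];
    congr (_ - I _ _); apply/funext => t /=; rewrite subrK.
apply: cvgB.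
  apply: cvgM; first exact: weak_cvg_end.
  by apply/cvgrPdist_le => e /AA0; apply: filterS => n /(_ _ TT); rewrite distrC.
rewrite -[X in _ --> X]add0r; apply: cvgD; last first.
  by apply: vv0; case: cA0.
rewrite -[X in _ --> X]add0r; apply: cvgD.
  apply: (gliding_hump (T := T) (L := fun n f => I f (v n) - I f v0)) => //.
  - move=> n f g cf cg; rewrite !stieltjes_integralD; try exact: bm.
    by rewrite opprD addrACA.
  - move=> n.
    have [C C0 CP] := stieltjes_integral_bound T (v n).
    have [D D0 DP] := stieltjes_integral_bound T v0.
    exists (C + D); first exact: addr_ge0.
    move=> f M cf fM; apply: le_trans (ler_normB _ _) _; rewrite mulrDl lerD//.
      by apply: CP => //; exact: bm.
    by apply: DP => //; exact: bm.
  - move=> f cf; rewrite -(subrr (I f v0)); apply: cvgB; last exact: cvg_cst.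
    by apply: vv0; apply/continuous_onP.
  - by move=> n; exact: continuous_onB.
have [D D0 DP] := stieltjes_integral_bound T v0.
apply/cvgrPdist_le => e e0; have D1 : 0 < D + 1 by rewrite ltr_wpDl.
have := AA0 _ (divr_gt0 e0 D1); apply: filterS => n h.
rewrite sub0r normrN; apply: le_trans (DP _ _ _ h) _.
  by apply: bm; exact: continuous_onB.
by rewrite mulrCA ler_piMr ?(ltW e0)// ler_pdivrMr// mul1r lerDl.
Qed.

Lemma S_cvg_tau (x : nat -> cadlag T) (x0 : cadlag T) A A0 : S_cvg x x0 ->
  (forall n, continuous_bv T (A n)) -> continuous_bv T A0 -> tau_cvg T A A0 ->
  I (x n) (A n) @[n --> \oo] --> I x0 A0.
Proof.
move=> xx0 cA cA0 tA; have [_ [C CP]] := (tau_cvgP T0 A A0).1 tA.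
(* [B] bounds the variation of every integrator, so moving an integrand by [e / 3 / (B + 1)] changes
   any of the integrals by at most [e / 3]. *)
pose B := Num.max C (fine (tvnorm T A0)).
have fin f : continuous_bv T f -> tvnorm T f \is a fin_num.
  by move=> [_ ft _]; rewrite ge0_fin_numE// tvnorm_ge0.
have AB n : fine (tvnorm T (A n)) <= B.
  by rewrite /B le_max -lee_fin fineK ?CP//; exact: fin.
have A0B : fine (tvnorm T A0) <= B by rewrite /B le_max lexx orbT.
have B0 : 0 <= B by apply: le_trans A0B; rewrite fine_ge0// tvnorm_ge0.
have B1 : 0 < B + 1 by rewrite ltr_wpDl.
apply/cvgrPdist_le => e e0; have e30 : 0 < e / 3 by rewrite divr_gt0.
have d0 := divr_gt0 e30 B1.
have [v [v0 [[bv bv0] /(_ _)/supnorm_leP xv /supnorm_leP xv0 vv0]]] := xx0 _ d0.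
have key (y w : cadlag T) F : continuous_bv T F -> fine (tvnorm T F) <= B ->
    (forall t, 0 <= t <= T -> `|(y \- w) t| <= e / 3 / (B + 1)) -> `|I y F - I w F| <= e / 3.
  move=> cF FB yw; rewrite -stieltjes_integralB.
  - apply: le_trans (integral_continuous_bv_bound T0 _ cF (M := e / 3 / (B + 1)) _) _.
    + by apply: cadlag_onB; exact: cadlag_cadlag_on.
    + by move=> t /andP[t0 tT]; apply: yw; rewrite t0 ltW.
    apply: (@le_trans _ _ (e / 3 / (B + 1) * B)); first by rewrite ler_wpM2l// ltW.
    by rewrite -mulrA ler_piMr ?(ltW e30)// mulrC ler_pdivrMr// mul1r lerDl.
  - by apply: (cadlag_bounded_measurable T0); exact: cadlag_cadlag_on.
  - by apply: (cadlag_bounded_measurable T0); exact: cadlag_cadlag_on.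
have /cvgrPdist_le/(_ _ e30) := weak_cvg_tau bv bv0 vv0 cA cA0 tA.
apply: filterS => n h; have h0 := key _ _ _ cA0 A0B xv0.
have h1 := key _ _ _ (cA n) (AB n) (xv n).
exact: dist_thirds h0 h h1.
Qed.

(* [S_cvg] limits of functionals varying with [n] pass to the topology without
   the subsequence description of topological convergence: the set [U] below is
   open because, if [y] were an [S_cvg] limit of points outside it, the indices
   violating the bound would have to tend to infinity. *)
Lemma topological_functional_cvg (g : nat -> cadlag T -> R) (g0 : cadlag T -> R) :
  (forall n y y0, S_cvg y y0 -> g n (y k) @[k --> \oo] --> g n y0) ->
  (forall y y0, S_cvg y y0 -> g0 (y k) @[k --> \oo] --> g0 y0) ->
  (forall y y0 (phi : nat -> nat), phi @ \oo --> \oo -> S_cvg y y0 ->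
    g (phi k) (y k) @[k --> \oo] --> g0 y0) ->
  forall (x : nat -> cadlag T) (x0 : cadlag T), x @ \oo --> x0 ->
  g n (x n) @[n --> \oo] --> g0 x0.
Proof.
move=> gc g0c gg0 x x0 xx0; apply/cvgrPdist_lt => e e0.
have /cvgrPdist_lt/(_ _ e0)[N _ NP] : g n x0 @[n --> \oo] --> g0 x0.
  by apply: (gg0 _ _ id) => //; exact: S_cvg_cst.
pose U := [set y : cadlag T | `|g0 x0 - g0 y| < e /\
  forall n, (N <= n)%N -> `|g0 x0 - g n y| < e].
have oU : open U.
  move=> y y0 nUy yy0 [Uy0 Uy1].
  (* When the bound on [g0] holds at [y k], some index [phi k] must be responsible for [y k] lying
     outside [U]. *)
  have /choice[phi phiP] : forall k, exists n, `|g0 x0 - g0 (y k)| < e ->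
      (N <= n)%N /\ e <= `|g0 x0 - g n (y k)|.
    move=> k; apply: contrapT => nk; apply: (nUy k); split.
      by apply: contrapT => h; apply: nk; exists 0%N => /h.
    move=> n Nn; rewrite ltNge; apply/negP => h; apply: nk; exists n => _.
    by [].
  have near0 : \forall k \near \oo, `|g0 x0 - g0 (y k)| < e.
    have /cvgr_lt/(_ _ Uy0) : `|g0 x0 - g0 (y k)| @[k --> \oo] --> `|g0 x0 - g0 y0|.
      by apply: cvg_norm; apply: cvgB; [exact: cvg_cst|exact: g0c].
    by [].
  have phioo : phi @ \oo --> \oo.
    (* Each value [m] of [phi] is eventually excluded: either [m < N], or [g m] satisfies the strict
       bound at [y0] and hence at [y k] for large [k]. *)
    apply/cvgnyPge => m; elim: m => [|m IHm]; first by near=> k.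
    have [Nm|mN] := leqP N m; last first.
      move: near0; apply: filterS => k /phiP[Nk _].
      exact: leq_trans mN Nk.
    have : \forall k \near \oo, `|g0 x0 - g m (y k)| < e.
      have /cvgr_lt/(_ _ (Uy1 m Nm)) : `|g0 x0 - g m (y k)| @[k --> \oo] --> `|g0 x0 - g m y0|.
        by apply: cvg_norm; apply: cvgB; [exact: cvg_cst|exact: gc].
      by [].
    move: near0 IHm; apply: filterS3 => k /phiP[_ h]; rewrite leq_eqVlt.
    move=> /predU1P[mk|//]; by rewrite mk ltNge h.
  have /cvgr_lt/(_ _ Uy0) : `|g0 x0 - g (phi k) (y k)| @[k --> \oo] --> `|g0 x0 - g0 y0|.
    by apply: cvg_norm; apply: cvgB; [exact: cvg_cst|exact: gg0].
  move=> near1; have : \forall k \near \oo, False.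
    by move: near0 near1; apply: filterS2 => k /phiP[_]; rewrite ltNge => ->.
  by move=> /filter_ex[].
have Ux0 : U x0 by split; [rewrite subrr normr0|exact: NP].
have := xx0 U (open_nbhs_nbhs (conj oU Ux0)).
have := nbhs_infty_ge N.
by apply: filterS2 => n Nn [_]; apply.
Unshelve. all: by end_near. Qed.

Lemma tau_cvg_cst F : continuous_bv T F -> tau_cvg T (fun=> F) F.
Proof.
move=> cF; apply/(tau_cvgP T0); split.
  by move=> e e0; near=> n => t _; rewrite subrr normr0 ltW.
exists (fine (tvnorm T F)) => _; rewrite fineK// ge0_fin_numE ?tvnorm_ge0//.
by case: cF.
Unshelve. all: by end_near. Qed.

Lemma topological_tau_cvg (x : nat -> cadlag T) (x0 : cadlag T) A A0 :
  x @ \oo --> x0 ->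
  (forall n, continuous_bv T (A n)) -> continuous_bv T A0 -> tau_cvg T A A0 ->
  I (x n) (A n) @[n --> \oo] --> I x0 A0.
Proof.
move=> xx0 cA cA0 tA.
apply: (topological_functional_cvg (g := fun n y => I y (A n)) (g0 := fun y => I y A0)) xx0.
- by move=> n y y0 /S_cvg_tau; apply => //; exact: tau_cvg_cst.
- by move=> y y0 /S_cvg_tau; apply => //; exact: tau_cvg_cst.
- move=> y y0 phi phioo /S_cvg_tau; apply => //.
  have /(tau_cvgP T0)[u [C CP]] := tA.
  by apply/(tau_cvgP T0); split; [move=> e /u /phioo|exists C].
Qed.

Lemma topological_end_cvg (x : nat -> cadlag T) (x0 : cadlag T) :
  x @ \oo --> x0 -> x n T @[n --> \oo] --> x0 T.
Proof.
by apply: (topological_functional_cvg (g := fun n y => y T) (g0 := fun y => y T)) => *;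
  exact: S_cvg_end.
Qed.

End direct.

(** * Compactness of S-bounded sequences *)

(** An ultrafilter finer than the filter at infinity yields all limits [p j] at once, by compactness
    of segments. Step [k] then picks an index, at least [k], at which the finitely many coordinates
    with code below [k] are within [1 / (k + 1)] of their limits. *)
Lemma diagonal_subsequence {R : realType} (J : countType) (u : nat -> J -> R) :
  (forall j, exists M, \forall n \near \oo, `|u n j| <= M) ->
  exists (phi : nat -> nat) (p : J -> R), phi @ \oo --> \oo /\
    forall j, u (phi k) j @[k --> \oo] --> p j.
Proof.
move=> ub; have [G [GU ooG]] := ultraFilterLemma (eventually_filter : ProperFilter \oo).
have GP : ProperFilter G by exact: ultra_proper.
have /choice[p pP] : forall j, exists p, forall e, 0 < e -> G [set n | `|p - u n j| < e].
  move=> j; have [M uM] := ub j.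
  have FP : ProperFilter ((u ^~ j) @ G) by exact: fmap_proper_filter.
  have FM : ((u ^~ j) @ G) `[- M, M]%classic.
    by apply: ooG; apply: filterS uM => n /=; rewrite in_itv/= ler_norml.
  have [p [_ pc]] := @segment_compact R (- M) M _ FP FM.
  exists p => e e0; have [//|nG] := in_ultra_setVsetC [set n | `|p - u n j| < e] GU.
  have [y [+ pe]] := pc (~` ball p e) (ball p e) nG (nbhsx_ballx p e e0).
  by [].
have step k : exists n, (k <= n)%N /\
    forall j, (pickle j < k)%N -> `|p j - u n j| < k.+1%:R^-1.
  have Gk : G [set n | (k <= n)%N] by apply: ooG; exact: nbhs_infty_ge.
  have GJ : \forall n \near G, forall i : 'I_k, forall j, pickle j = i ->
      `|p j - u n j| < k.+1%:R^-1.
    apply: filter_forall => i; have [[j ji]|nj] := pselect (exists j : J, pickle j = i).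
      have := pP j _ (_ : 0 < k.+1%:R^-1); rewrite invr_gt0 ltr0n => /(_ isT).
      apply: filterS => n h j' j'i; suff -> : j' = j by [].
      by apply: (pcan_inj pickleK); rewrite j'i ji.
    by near=> n => j ji; exfalso; apply: nj; exists j.
  have [n [kn h]] := @filter_ex _ G GP _ (@filterI _ G _ _ _ Gk GJ).
  by exists n; split => // j jk; exact: (h (Ordinal jk)).
have {step}[phi phiP] := choice step.
exists phi, p; split.
  by apply/cvgnyPge => m; exists m => // k /= mk; apply: leq_trans mk _; case: (phiP k).
move=> j; apply/cvgrPdist_lt => e e0.
have near1 := near_infty_natSinv_lt (PosNum e0).
have near2 := nbhs_infty_gt (pickle j).
move: near1 near2; apply: filterS2 => k ke kj.
by apply: lt_trans ke; case: (phiP k) => _; apply.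
Unshelve. all: by end_near. Qed.

(** * Ramps as approximate evaluations at a point *)

Section ramp.
Context {R : realType}.
Variable T : R.
Hypothesis T0 : 0 < T.
Implicit Types (t h s : R) (x : R -> R).
Local Notation I := (stieltjes_integral T).

Definition ramp t h s : R := Num.max 0 (Num.min 1 ((s - t) / h)).

Lemma ramp_itv t h s : 0 <= ramp t h s <= 1.
Proof. by rewrite /ramp le_max lexx/= ge_max ler01 ge_min lexx. Qed.

Lemma ramp0 t h s : 0 < h -> s <= t -> ramp t h s = 0.
Proof.
move=> h0 st; rewrite /ramp max_l// ge_min; apply/orP; right.
by rewrite ler_pdivrMr// mul0r subr_le0.
Qed.

Lemma ramp1 t h s : 0 < h -> t + h <= s -> ramp t h s = 1.
Proof.
move=> h0 st; rewrite /ramp min_l; first by rewrite max_r.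
by rewrite ler_pdivlMr// mul1r lerBrDr addrC.
Qed.

Lemma le_ramp t t' h s s' : 0 < h -> t' <= t -> s <= s' ->
  ramp t h s <= ramp t' h s'.
Proof.
move=> h0 tt ss; rewrite /ramp ge_max !le_max lexx/= le_min !ge_min lexx/=.
by rewrite ler_pM2r ?invr_gt0// (lerB ss tt) !orbT.
Qed.

Lemma continuous_ramp t h : continuous (ramp t h).
Proof.
have cmax (f g : R -> R) : continuous f -> continuous g ->
    continuous (fun s => Num.max (f s) (g s)).
  move=> cf cg s; rewrite /continuous_at maxr_absE; under eq_fun do rewrite maxr_absE.
  apply: cvgM; last exact: cvg_cst.
  by apply: cvgD; [apply: cvgD|apply: cvg_norm; apply: cvgB]; do ?exact: cf; exact: cg.
have cmin (f g : R -> R) : continuous f -> continuous g ->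
    continuous (fun s => Num.min (f s) (g s)).
  move=> cf cg s; rewrite /continuous_at minr_absE; under eq_fun do rewrite minr_absE.
  apply: cvgM; last exact: cvg_cst.
  by apply: cvgB; [apply: cvgD|apply: cvg_norm; apply: cvgB]; do ?exact: cf; exact: cg.
apply: cmax; first by move=> s; exact: cvg_cst.
apply: cmin; first by move=> s; exact: cvg_cst.
by move=> s; apply: cvgM; [apply: cvgB; [exact: cvg_id|exact: cvg_cst]|exact: cvg_cst].
Qed.

Lemma tvnorm_ramp t h : 0 < h -> (tvnorm T (ramp t h) <= 1%:E)%E.
Proof.
move=> h0; rewrite tvnorm_nondecreasing//; last by move=> a b _ _; exact: le_ramp.
have /andP[r0 _] := ramp_itv t h 0; have /andP[_ r1] := ramp_itv t h T.
by rewrite lee_fin ger0_norm// addrC subrK.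
Qed.

Lemma continuous_bv_ramp t h : 0 <= t -> 0 < h -> continuous_bv T (ramp t h).
Proof.
move=> t0 h0; split; last exact: ramp0.
  by apply: continuous_subspaceT; exact: continuous_ramp.
by apply: le_lt_trans (tvnorm_ramp t h0) _; exact: ltry.
Qed.

(** No cell has [t] in its interior. Cells before [t] or after [t + h] carry no increment of the
    ramp, and the others start in [t, t + h[, where [x] is close to [x t]. *)
Lemma rsum_ramp x t h e a (s : seq R) : 0 < h -> 0 <= e ->
  (forall u, t <= u < t + h -> `|x u - x t| <= e) ->
  mesh (fun a b => a < b /\ (b <= t \/ t <= a)) a s ->
  `|rsum x (ramp t h) a s - x t * (ramp t h (last a s) - ramp t h a)| <=
    e * (ramp t h (last a s) - ramp t h a).
Proof.
move=> h0 e0 xe; elim: s a => [|b s IHs] a /=.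
  by move=> _; rewrite subrr !mulr0 subrr normr0.
move=> [[ab abt] /IHs{}IHs].
set L := ramp t h (last b s) in IHs *.
rewrite (_ : _ - _ = (x a - x t) * (ramp t h b - ramp t h a) +
  (rsum x (ramp t h) b s - x t * (L - ramp t h b))); last by ring.
rewrite (_ : e * _ = e * (ramp t h b - ramp t h a) + e * (L - ramp t h b)); last by ring.
apply: le_trans (ler_normD _ _) _; apply: lerD => //.
have rab : 0 <= ramp t h b - ramp t h a by rewrite subr_ge0 le_ramp// ltW.
rewrite normrM (ger0_norm rab).
case: abt => [bt|ta]; first by rewrite !ramp0 ?subrr ?mulr0 ?(le_trans (ltW ab)).
have [ath|tha] := ltP a (t + h); first by rewrite ler_wpM2r// xe// ta.
by rewrite !ramp1 ?subrr ?mulr0 ?(le_trans tha (ltW ab)).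
Qed.

(** The integral is the mean of [x] over [t, t + h], so right continuity gives the limit. A ramp at
    [T] would vanish on [0, T]. *)
Lemma integral_ramp_cvg x t : cadlag_on T x -> 0 <= t < T ->
  I x (ramp t h) @[h --> 0^'+] --> x t.
Proof.
move=> cx /andP[t0 tT]; apply/cvgrPdist_le => e e0.
have cxt : x @ t^'+ --> x t by apply: cx.1; rewrite t0.
have near1 : \forall h \near 0^'+, rmesh x e t (t + h).
  have [d /= d0 dP] := near_rmesh e0 cxt.
  near=> h; have h0 : 0 < h by near: h; exact: nbhs_right_gt.
  have hd : h < d by near: h; exact: nbhs_right_lt.
  apply: dP; last by rewrite ltrDl.
  by rewrite /= opprD addrA subrr sub0r normrN gtr0_norm.
near=> h.
have h0 : 0 < h by near: h; exact: nbhs_right_gt.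
have hT : t + h <= T.
  by rewrite addrC -lerBrDr; near: h; apply: nbhs_right_le; rewrite subr_gt0.
have [_ xe] : rmesh x e t (t + h) by near: h.
rewrite distrC; have [C C0 CP] := rsum_approx T0 (continuous_bv_ramp t0 h0).
apply/ler_addgt0Pr => d d0; have C1 : 0 < C + 1 by rewrite ltr_wpDl.
have d'0 := divr_gt0 d0 C1.
(* The second condition forces [t] to be a node of the partition. *)
have [|u uT|u uT|s ms ls] :=
    @partition_exists _ (fun a b => rmesh x (d / (C + 1)) a b /\ (b <= t \/ t <= a)) 0 T.
- exact: ltW.
- apply: filterI; first by apply: near_rmesh => //; exact: cx.1.
  have [ut|tu] := ltP u t; last by near=> w; right.
  by near=> w; left; near: w; exact: nbhs_right_le.
- apply: filterI; first by apply: near_rmesh_left => //; exact: cx.2.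
  have [ut|tu] := leP u t; first by near=> w; left.
  by near=> w; right; near: w; exact: nbhs_left_ge.
have ms1 : mesh (rmesh x (d / (C + 1))) 0 s by apply: mesh_sub ms => ? ? [].
have ms2 : mesh (fun a b => a < b /\ (b <= t \/ t <= a)) 0 s.
  by apply: mesh_sub ms => ? ? [[]].
have h1 := CP _ _ _ cx (ltW d'0) ms1 ls.
have := rsum_ramp h0 (ltW e0) xe ms2.
rewrite ls ramp1// (ramp0 h0 t0) subr0 !mulr1 => h2.
rewrite -(subrK (rsum x (ramp t h) 0 s) (I x _)) -addrA addrC.
apply: le_trans (ler_normD _ _) _; apply: lerD => //.
apply: le_trans h1 _.
by rewrite mulrCA ler_piMr ?(ltW d0)// ler_pdivrMr// mul1r lerDl.
Unshelve. all: by end_near. Qed.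

End ramp.

(** * Telescoping ramps that detect oscillations *)

Section zigzag.
Context {R : realType}.
Variable T : R.
Hypothesis T0 : 0 < T.
Implicit Types (t h y : R) (x : R -> R) (s : seq R).
Local Notation I := (stieltjes_integral T).

(** The signs make the integral of [x] tend, as [h] goes to 0, to the sum of the absolute increments
    of [x] along the chain. *)
Fixpoint zigzag x h y s t : R :=
  if s is b :: s' then
    Num.sg (x b - x y) * (ramp b h t - ramp y h t) + zigzag x h b s' t
  else 0.

Fixpoint oscillation_sum x y s : R :=
  if s is b :: s' then `|x b - x y| + oscillation_sum x b s' else 0.

Lemma zigzag_cons x h y b s : zigzag x h y (b :: s) =
  (fun t => Num.sg (x b - x y) * (ramp b h \+ (fun t => -1 * ramp y h t)) t)
  \+ zigzag x h b s.
Proof. by apply/funext => t /=; rewrite mulN1r. Qed.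

Lemma continuous_bv_rampB a b c h : 0 <= a -> 0 <= b -> 0 < h ->
  continuous_bv T (fun t => c * (ramp a h \+ (fun t => -1 * ramp b h t)) t).
Proof.
move=> a0 b0 h0; apply: (continuous_bvZ T0); apply: (continuous_bvD T0).
  exact: continuous_bv_ramp.
by apply: (continuous_bvZ T0); exact: continuous_bv_ramp.
Qed.

Lemma continuous_bv_zigzag x h y s : 0 < h -> 0 <= y -> mesh ltmesh y s ->
  continuous_bv T (zigzag x h y s).
Proof.
move=> h0; elim: s y => [|b s IHs] y y0 /=; first by move=> _; exact: continuous_bv0.
move=> [yb ms]; have b0 := le_trans y0 (ltW yb).
rewrite -/(zigzag x h y (b :: s)) zigzag_cons; apply: (continuous_bvD T0); last exact: IHs.
exact: continuous_bv_rampB.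
Qed.

(** Whatever the signs, the nonnegative differences [ramp y h t - ramp b h t] telescope. So a zigzag
    is bounded by 1 however many points it has, and division by their number makes it uniformly
    small. *)
Lemma zigzag_bound x h y s t : 0 < h -> mesh ltmesh y s ->
  `|zigzag x h y s t| <= ramp y h t - ramp (last y s) h t.
Proof.
move=> h0; elim: s y => [|b s IHs] y /=; first by rewrite normr0 subrr.
move=> [yb /IHs{}IHs].
have -> : ramp y h t - ramp (last b s) h t =
  (ramp y h t - ramp b h t) + (ramp b h t - ramp (last b s) h t) by ring.
apply: le_trans (ler_normD _ _) _; apply: lerD => //.
rewrite normrM distrC (@ger0_norm _ (ramp y h t - _)); last first.
  by rewrite subr_ge0 le_ramp// ltW.
rewrite ler_piMl//; first by rewrite subr_ge0 le_ramp// ltW.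
by rewrite normr_sg; case: (_ != 0).
Qed.

Lemma tvnorm_zigzag x h y s : 0 < h -> 0 <= y -> mesh ltmesh y s ->
  (tvnorm T (zigzag x h y s) <= (2 * (size s)%:R)%:E)%E.
Proof.
move=> h0; elim: s y => [|b s IHs] y y0 /=.
  rewrite mulr0 => _; rewrite tvnorm_nondecreasing//.
  by rewrite !subrr addr0 normr0.
move=> [yb ms]; have b0 := le_trans y0 (ltW yb).
rewrite -/(zigzag x h y (b :: s)) zigzag_cons.
apply: le_trans (tvnormD T0 _ _) _.
have -> : 2 * (size s).+1%:R = 2 + 2 * (size s)%:R :> R.
  by rewrite -addn1 natrD; ring.
rewrite EFinD; apply: leeD; last exact: IHs.
apply: le_trans (tvnormZ T0 _ _) _.
apply: (@le_trans _ _ (1%:E * tvnorm T (ramp b h \+ (fun t => -1 * ramp y h t))%R)%E).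
  rewrite lee_wpmul2r ?tvnorm_ge0// lee_fin normr_sg.
  by case: (_ != 0).
rewrite mul1e; apply: le_trans (tvnormD T0 _ _) _.
have -> : 2%:E = (1%:E + 1%:E : \bar R)%E by rewrite -EFinD.
apply: leeD; first exact: tvnorm_ramp.
apply: le_trans (tvnormZ T0 _ _) _.
by rewrite normrN normr1 mul1e; exact: tvnorm_ramp.
Qed.

Lemma integral_zero x : cadlag_on T x -> I x (fun=> 0) = 0.
Proof.
move=> cx; rewrite -[RHS](mul0r (I x (fun=> 0))).
rewrite -(integral_continuous_bvZ T0 0 cx (continuous_bv0 T0)).
by congr (I x _); apply/funext => t; rewrite mulr0.
Qed.

Lemma integral_zigzag_cvg x y s : cadlag_on T x -> 0 <= y -> mesh ltmesh y s ->
  last y s < T -> I x (zigzag x h y s) @[h --> 0^'+] --> oscillation_sum x y s.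
Proof.
move=> cx; elim: s y => [|b s IHs] y y0 /= ms lT.
  apply: cvg_near_cst; near=> h.
  exact: integral_zero.
case: ms => yb ms; have b0 := le_trans y0 (ltW yb).
have bT : b < T := le_lt_trans (mesh_lt_last ms) lT.
have cvb : I x (ramp b h) @[h --> 0^'+] --> x b.
  by apply: integral_ramp_cvg => //; rewrite b0.
have cvy : I x (ramp y h) @[h --> 0^'+] --> x y.
  by apply: integral_ramp_cvg => //; rewrite y0 (lt_trans yb).
have -> : `|x b - x y| + oscillation_sum x b s =
    Num.sg (x b - x y) * (x b - x y) + oscillation_sum x b s.
  by rewrite -normrEsg.
have H : Num.sg (x b - x y) * (I x (ramp b h) - I x (ramp y h)) +
    I x (zigzag x h b s) @[h --> 0^'+] -->
    Num.sg (x b - x y) * (x b - x y) + oscillation_sum x b s.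
  apply: cvgD; last exact: (IHs _ b0 ms lT).
  by apply: cvgM; [exact: cvg_cst|exact: cvgB].
apply: cvg_trans H; apply: near_eq_cvg; near=> h.
have h0 : 0 < h by near: h; exact: nbhs_right_gt.
rewrite -/(zigzag x h y (b :: s)) zigzag_cons.
have cb := continuous_bv_ramp T0 b0 h0; have cy := continuous_bv_ramp T0 y0 h0.
have cN := continuous_bvZ T0 (-1) cy.
rewrite (integral_continuous_bvD T0 cx); last 2 first.
- exact: continuous_bv_rampB.
- exact: continuous_bv_zigzag.
rewrite (integral_continuous_bvZ T0 _ cx (continuous_bvD T0 cb cN)).
rewrite (integral_continuous_bvD T0 cx cb cN) (integral_continuous_bvZ T0 _ cx cy).
by rewrite mulN1r.
Unshelve. all: by end_near. Qed.

Lemma oscillation_sum_ge x e y s : mesh (oscillation x e) y s ->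
  e * (size s)%:R <= oscillation_sum x y s.
Proof.
elim: s y => [|b s IHs] y /=; first by rewrite mulr0.
move=> [[_ eb] /IHs]; rewrite -addn1 natrD mulrDr mulr1 addrC => h.
by apply: lerD => //; exact: ltW.
Qed.

End zigzag.

(** * Equicontinuity of the functionals; bounds on size and oscillations *)

Section converse.
Context {R : realType}.
Variable T : R.
Hypothesis T0 : 0 < T.
Local Notation I := (stieltjes_integral T).

Definition tau_tested (x : nat -> cadlag T) (x0 : cadlag T) :=
  forall (A : nat -> R -> R) (A0 : R -> R),
    (forall n, continuous_bv T (A n)) -> continuous_bv T A0 -> tau_cvg T A A0 ->
    I (x n) (A n) @[n --> \oo] --> I x0 A0.

(** Off the range of [phi] the integrators are filled in with [A0], which preserves
    tau-convergence. *)
Lemma tau_tested_subseq (phi : nat -> nat) x x0 :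
  (forall k, (phi k < phi k.+1)%N) -> tau_tested x x0 -> tau_tested (x \o phi) x0.
Proof.
move=> phiS xx0 A A0 cA cA0 /(tau_cvgP T0)[AA0 [C CP]].
have phi_lt : {homo phi : i j / (i < j)%N} by exact: (homo_ltn ltn_trans phiS).
have phi_ge k : (k <= phi k)%N.
  by elim: k => // k IHk; exact: leq_ltn_trans IHk (phiS k).
have phi_inj : injective phi.
  by move=> i j; case: (ltngtP i j) => // /phi_lt + e; rewrite e ltnn.
pose B n := if pselect (exists k, phi k = n) is left e then A (projT1 (cid e)) else A0.
have BA k : B (phi k) = A k.
  rewrite /B; case: pselect => [e|]; last by case; exists k.
  by case: cid => j /= /phi_inj ->.
have Bcase n : B n = A0 \/ exists2 k, n = phi k & B n = A k.
  rewrite {1 2}/B; case: pselect => [e|]; last by left.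
  by right; case: cid => j /= <-; exists j.
have : I (x n) (B n) @[n --> \oo] --> I x0 A0.
  apply: xx0 => //.
    by move=> n; case: (Bcase n) => [->|[k _ ->]].
  apply/(tau_cvgP T0); split.
    move=> e e0; have [N _ NP] := AA0 e e0; exists (phi N) => // n /= Nn t tT.
    case: (Bcase n) => [->|[k nk ->]]; first by rewrite subrr normr0 ltW.
    apply: NP => //=; rewrite leqNgt; apply/negP => /phi_lt.
    by rewrite -nk ltnNge Nn.
  have f0 : tvnorm T A0 \is a fin_num.
    by case: cA0 => _ ? _; rewrite ge0_fin_numE ?tvnorm_ge0.
  exists (Num.max C (fine (tvnorm T A0))) => n.
  case: (Bcase n) => [->|[k _ ->]]; first by rewrite -{1}(fineK f0) lee_fin le_max lexx orbT.
  by apply: le_trans (CP k) _; rewrite lee_fin le_max lexx.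
move=> h; have phioo : phi @ \oo --> \oo.
  by apply/cvgnyPge => m; exists m => // k /= mk; exact: leq_trans (phi_ge k).
have := cvg_comp phi (fun n => I (x n) (B n)) phioo h.
by apply: cvg_trans; apply: near_eq_cvg; near=> k; rewrite /= BA.
Unshelve. all: by end_near. Qed.

(** Each level [m k.+1] is one more than the index [phi k] just found. An index found at level [j]
    is at least [j], so levels and indices both increase. *)
Lemma extract_increasing (P : nat -> nat -> Prop) :
  (forall k, exists n, (k <= n)%N /\ P k n) ->
  exists m phi : nat -> nat, forall k,
    [/\ (k <= m k)%N, (phi k < phi k.+1)%N & P (m k) (phi k)].
Proof.
move=> /choice[f fP]; pose m k := iter k (fun j => (f j).+1) 0%N.
have mS k : m k.+1 = (f (m k)).+1 by [].
exists m, (f \o m) => k; split; last by case: (fP (m k)).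
  by elim: k => // k IHk; rewrite mS ltnS (leq_trans IHk)//; case: (fP (m k)).
by case: (fP (f (m k)).+1).
Qed.

(** Failure for all [d] and [N] gives, along a subsequence, integrators of variation at most [C]
    that tend uniformly to 0 while their integrals exceed [e]. They tau-converge to the zero
    integrator, a contradiction. *)
Lemma tau_tested_equicontinuous x x0 : tau_tested x x0 -> forall C e, 0 < e ->
  exists d N, 0 < d /\ forall n, (N <= n)%N -> forall A, continuous_bv T A ->
    (tvnorm T A <= C%:E)%E -> (forall t, 0 <= t <= T -> `|A t| <= d) ->
    `|I (x n) A| <= e.
Proof.
move=> tx C e e0; apply: contrapT => ne.
pose P k n := exists A, [/\ continuous_bv T A, (tvnorm T A <= C%:E)%E,
  forall t, 0 <= t <= T -> `|A t| <= k.+1%:R^-1 & e < `|I (x n) A|].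
have /extract_increasing[m [phi mP]] : forall k, exists n, (k <= n)%N /\ P k n.
  move=> k; apply: contrapT => nk; apply: ne; exists k.+1%:R^-1, k; split => //.
  move=> n kn A cA tA Ad; rewrite leNgt; apply/negP => eA; apply: nk.
  by exists n; split => //; exists A.
have /choice[A AP] : forall k, exists A, [/\ continuous_bv T A, (tvnorm T A <= C%:E)%E,
    forall t, 0 <= t <= T -> `|A t| <= (m k).+1%:R^-1 & e < `|I (x (phi k)) A|].
  by move=> k; case: (mP k) => _ _ [A]; exists A.
have cA k : continuous_bv T (A k) by case: (AP k).
have tA : tau_cvg T A (fun=> 0).
  apply/(tau_cvgP T0); split; last by exists C => k; case: (AP k).
  move=> d d0; have := near_infty_natSinv_lt (PosNum d0).
  apply: filterS => k kd t tT; rewrite subr0; case: (AP k) => _ _ /(_ t tT) h _.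
  apply: le_trans h _; apply: le_trans (ltW kd).
  by rewrite lef_pV2 ?posrE ?ltr0n// ler_nat ltnS; case: (mP k).
have phiS k : (phi k < phi k.+1)%N by case: (mP k).
have := tau_tested_subseq phiS tx cA (continuous_bv0 T0) tA.
rewrite integral_zero//; last exact: cadlag_cadlag_on.
move=> /cvgrPdist_le/(_ _ e0) /filter_ex[k].
by rewrite sub0r normrN leNgt; case: (AP k) => _ _ _ ->.
Qed.

(** A ramp times [w] has size at most [d] and variation at most 1, so its integral is at most 1 and
    the values of [x n] before [T] are at most [w^-1]. At [T] the convergence of [x n T] is used. *)
Lemma tau_tested_bounded x x0 : tau_tested x x0 -> x n T @[n --> \oo] --> x0 T ->
  exists M, \forall n \near \oo, forall t, 0 <= t <= T -> `|x n t| <= M.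
Proof.
move=> tx xT; have [d [N [d0 dP]]] := tau_tested_equicontinuous tx 1 ltr01.
pose w := Num.min d 1; have w0 : 0 < w by rewrite /w lt_min d0/=.
exists (Num.max w^-1 (`|x0 T| + 1)).
have := nbhs_infty_ge N.
move/cvgrPdist_le : xT => /(_ _ ltr01); apply: filterS2 => n xT Nn t /andP[t0].
rewrite le_eqVlt le_max => /predU1P[->|tT]; apply/orP; [right|left].
  rewrite (_ : x n T = x0 T - (x0 T - x n T)); last by ring.
  by apply: le_trans (ler_normB _ _) _; rewrite lerD2l.
have cx := cadlag_cadlag_on (x n).
have tT' : 0 <= t < T by rewrite t0.
have h : `|I (x n) (ramp t h)| @[h --> 0^'+] --> `|x n t|.
  by apply: cvg_norm; exact: integral_ramp_cvg.
rewrite leNgt; apply/negP => wx.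
have /filter_ex[h0 [h0_gt0]] : \forall h \near 0^'+, 0 < h /\ w^-1 < `|I (x n) (ramp t h)|.
  apply: filterI; first exact: nbhs_right_gt.
  by move/cvgr_gt : h; apply.
apply/negP; rewrite -leNgt -[leRHS]mulr1 ler_pdivlMl//.
have cr := continuous_bv_ramp T0 t0 h0_gt0.
rewrite -(gtr0_norm w0) -normrM -(integral_continuous_bvZ T0 _ cx cr).
apply: dP => //; first exact: continuous_bvZ.
  apply: le_trans (tvnormZ T0 _ _) _; rewrite gtr0_norm//.
  apply: (@le_trans _ _ (w%:E * 1%:E)%E).
    by rewrite lee_wpmul2l ?lee_fin ?(ltW w0)// tvnorm_ramp.
  by rewrite mule1 lee_fin /w ge_min lexx orbT.
move=> s _; rewrite normrM gtr0_norm//; have /andP[r0 r1] := ramp_itv t h0 s.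
by rewrite ger0_norm// (@le_trans _ _ w)// ?ler_piMr ?(ltW w0)// /w ge_min lexx.
Qed.

(** A zigzag over [k] oscillations, divided by [k], has size at most [1 / k], variation at most 2
    and an integral whose limit as [h] goes to 0 is at least [e]. Equicontinuity with bound [e / 2]
    excludes this once [1 / k < d]. *)
Lemma tau_tested_oscillations x x0 e : tau_tested x x0 -> 0 < e ->
  exists K, \forall n \near \oo, forall s : seq R,
    mesh (oscillation (x n) e) 0 s -> last 0 s < T -> (size s <= K)%N.
Proof.
move=> tx e0; have e20 : 0 < e / 2 by rewrite divr_gt0.
have [d [N [d0 dP]]] := tau_tested_equicontinuous tx 2 e20.
have [K Kd] : exists K, K.+1%:R^-1 < d.
  by have /filter_ex := near_infty_natSinv_lt (PosNum d0); apply.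
exists K; have := nbhs_infty_ge N; apply: filterS => n Nn s ms lT.
rewrite leqNgt; apply/negP => Ks.
have ms' : mesh ltmesh 0 s by apply: mesh_sub ms => ? ? [].
have cx := cadlag_cadlag_on (x n).
pose w : R := (size s)%:R^-1.
have s0 : 0 < (size s)%:R :> R by rewrite ltr0n (leq_ltn_trans _ Ks).
have w0 : 0 < w by rewrite invr_gt0.
have os : e <= w * oscillation_sum (x n) 0 s.
  by rewrite mulrC ler_pdivlMr//; exact: oscillation_sum_ge.
have h : w * I (x n) (zigzag (x n) h 0 s) @[h --> 0^'+] --> w * oscillation_sum (x n) 0 s.
  by apply: cvgM; [exact: cvg_cst|exact: integral_zigzag_cvg].
have /filter_ex[h0 [h0_gt0]] : \forall h \near 0^'+, 0 < h /\
    e / 2 < w * I (x n) (zigzag (x n) h 0 s).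
  apply: filterI; first exact: nbhs_right_gt.
  move/cvgr_gt : h; apply; apply: lt_le_trans os.
  by rewrite ltr_pdivrMr// ltr_pMr// ltr1n.
apply/negP; rewrite -leNgt; apply: le_trans (ler_norm _) _.
have cz := continuous_bv_zigzag T0 (x n) h0_gt0 (lexx 0) ms'.
rewrite -(integral_continuous_bvZ T0 _ cx cz).
apply: dP => //; first exact: continuous_bvZ.
  apply: le_trans (tvnormZ T0 _ _) _; rewrite gtr0_norm//.
  apply: (@le_trans _ _ (w%:E * (2 * (size s)%:R)%:E)%E).
    by rewrite lee_wpmul2l ?lee_fin ?(ltW w0)// tvnorm_zigzag.
  by rewrite -EFinM lee_fin mulrCA mulVf ?mulr1// gt_eqF.
move=> t _; rewrite normrM gtr0_norm//; apply: (@le_trans _ _ w).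
  rewrite ler_piMr ?(ltW w0)//; apply: le_trans (zigzag_bound _ _ h0_gt0 ms') _.
  have /andP[_ r1] := ramp_itv 0 h0 t; have /andP[r0 _] := ramp_itv (last 0 s) h0 t.
  by rewrite lerBlDr (le_trans r1)// lerDl.
apply: le_trans (ltW Kd).
by rewrite /w lef_pV2 ?posrE ?ltr0n ?ler_nat// (leq_ltn_trans _ Ks).
Qed.

End converse.

Lemma sum_nth_default {V : zmodType} {S : Type} (F : S -> V) p0 l K :
  F p0 = 0 -> (size l <= K)%N -> \sum_(p <- l) F p = \sum_(i < K) F (nth p0 l i).
Proof.
move=> F0; elim: l K => [|p l IHl] K lK.
  by rewrite big_nil big1// => i _; rewrite nth_nil.
case: K lK => // K lK; rewrite big_cons big_ord_recl/=; congr (_ + _).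
exact: IHl.
Qed.

(** * Limits of jump data and the S-convergent subsequence *)

Section compactness.
Context {R : realType}.
Variable T : R.
Hypothesis T0 : 0 < T.
Local Notation I := (stieltjes_integral T).

Lemma continuous_on_cvg_seq (f : R -> R) (s : nat -> R) (t : R) :
  {within `[0, T], continuous f} -> (forall k, 0 <= s k <= T) -> 0 <= t <= T ->
  s k @[k --> \oo] --> t -> f (s k) @[k --> \oo] --> f t.
Proof.
move=> /subspace_continuousP cf sT tT st.
have tT' : `[0, T]%classic t by rewrite /= in_itv.
have sw : s @ \oo --> within `[0, T]%classic (nbhs t).
  move=> P Pt; have H : \forall k \near \oo, `[0, T]%classic (s k) -> P (s k) := st _ Pt.
  change (\forall k \near \oo, P (s k)); move: H; apply: filterS => k h; apply: h.
  by rewrite /= in_itv/=; exact: sT.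
exact: (cvg_comp s f sw (cf t tT')).
Qed.

Lemma all_increments_bound (x : R -> R) M y s : `|x y| <= M ->
  all (fun b => `|x b| <= M) s ->
  all (fun p => `|p.1| <= 2 * M) (increments x y s).
Proof.
elim: s y => //= b s IHs y yM /andP[bM sM]; rewrite IHs// andbT.
by apply: le_trans (ler_normB _ _) _; lra.
Qed.

Lemma jump_list_bound (x : R -> R) M e s : mesh ltmesh 0 s -> last 0 s = T ->
  (forall t, 0 <= t <= T -> `|x t| <= M) ->
  all (fun p => `|p.1| <= 2 * M) (jump_list x e s).
Proof.
move=> ms ls xM; have x0M : `|x 0| <= M by apply: xM; rewrite lexx ltW.
apply/andP; split => /=; first by have := normr_ge0 (x 0); lra.
apply: all_increments_bound => //.
have := keep_gt x e 0 ms (lexx 0); have := keep_le_last x e 0 ms; rewrite ls.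
move=> /allP kT /allP k0; apply/allP => b bk; apply: xM.
by rewrite (ltW (k0 b bk)) kT.
Qed.

(** The last retained point may be [T], to which the oscillation bound does not apply; dropping it
    accounts for [K.+1]. *)
Lemma keep_size (x : R -> R) e K s : mesh ltmesh 0 s -> last 0 s = T ->
  (forall s, mesh (oscillation x e) 0 s -> last 0 s < T -> (size s <= K)%N) ->
  (size (keep x e 0 s) <= K.+1)%N.
Proof.
move=> ms ls xK; have := keep_oscillation x e ms (lexx 0).
have := keep_le_last x e 0 ms; rewrite ls.
case/lastP: (keep _ _ _ _) => // l z; rewrite all_rcons size_rcons => /andP[zT _] ml.
have [ml' lz] : mesh (oscillation x e) 0 l /\ last 0 l < z.
  elim: l {zT} 0 ml => [|b l IHl] y /=; first by case=> -[].
  by move=> [yb /IHl[]].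
by rewrite ltnS xK// (lt_le_trans lz).
Qed.

(** Beyond its length a list is read as (0, 0), a jump of height 0, so lists of different lengths
    become vectors of length [K]. The integral of [f] is then a sum of [K] terms, each continuous in
    height and time. *)
Lemma jumps_weak_cvg (l : nat -> seq (R * R)) (K : nat) (p : nat -> R * R) l0
    (lT : forall k, jump_times T (l k)) (l0T : jump_times T l0) :
  l0 = mkseq p K -> (\forall k \near \oo, (size (l k) <= K)%N) ->
  (forall i, (nth (0, 0) (l k) i).1 @[k --> \oo] --> (p i).1) ->
  (forall i, (nth (0, 0) (l k) i).2 @[k --> \oo] --> (p i).2) ->
  weak_cvg (fun k => jumps_cadlag (lT k)) (jumps_cadlag l0T).
Proof.
move=> l0E lK l1 l2 f cf; have cf' := (continuous_onP T0 f).1 cf.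
rewrite /= (integral_jumps T0 cf' l0T).
have -> : \sum_(q <- l0) q.1 * f q.2 = \sum_(i < K) (p i).1 * f (p i).2.
  by rewrite l0E big_map -{1}[K]subn0 -[iota 0 (K - 0)]/(index_iota 0 K) big_mkord.
have H : \sum_(i < K) (nth (0, 0) (l k) i).1 * f (nth (0, 0) (l k) i).2 @[k --> \oo] -->
    \sum_(i < K) (p i).1 * f (p i).2.
  apply: cvg_big => [|i _]; first exact: add_continuous.
  apply: cvgM; first exact: l1.
  apply: continuous_on_cvg_seq => //.
    move=> k; have [ik|ki] := ltnP i (size (l k)).
      by have /(all_nthP (0, 0)) := lT k; apply.
    by rewrite nth_default//= lexx ltW.
  have : p i \in l0 by rewrite l0E; apply/mapP; exists (i : nat); rewrite // mem_iota ltn_ord.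
  by move=> /(allP l0T).
apply: cvg_trans H; apply: near_eq_cvg; move: lK; apply: filterS => k lK.
rewrite (integral_jumps T0 cf' (lT k)) (sum_nth_default (p0 := (0, 0)) _ lK)//=.
by rewrite mul0r.
Qed.

(** Two successive limits: for a fixed ramp the bound passes to the limit in [n] through the
    integrals, and then [h] goes to 0. At [T] the values themselves converge. *)
Lemma weak_cvg_approx_limit (x : nat -> cadlag T) (x0 : cadlag T)
    (v : nat -> cadlag T) (v0 : cadlag T) e :
  (forall A, continuous_bv T A -> I (x n) A @[n --> \oo] --> I x0 A) ->
  x n T @[n --> \oo] --> x0 T ->
  (forall n, bv_cadlag (v n)) -> bv_cadlag v0 -> weak_cvg v v0 ->
  (forall n t, 0 <= t <= T -> `|x n t - v n t| <= e) ->
  forall t, 0 <= t <= T -> `|x0 t - v0 t| <= e.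
Proof.
move=> tx xT bv bv0 vv0 xv t /andP[t0]; rewrite le_eqVlt => /predU1P[->|tT].
  have H : `|x n T - v n T| @[n --> \oo] --> `|x0 T - v0 T|.
    by apply: cvg_norm; apply: cvgB => //; exact: weak_cvg_end.
  apply: (cvgr_to_le H); near=> n; apply: xv; by rewrite lexx ltW.
have tT' : 0 <= t < T by rewrite t0.
have H : `|I x0 (ramp t h) - I v0 (ramp t h)| @[h --> 0^'+] --> `|x0 t - v0 t|.
  by apply: cvg_norm; apply: cvgB; apply: integral_ramp_cvg => //; exact: cadlag_cadlag_on.
apply: (cvgr_to_le H); near=> h.
have h0 : 0 < h by near: h; exact: nbhs_right_gt.
have cr := continuous_bv_ramp T0 t0 h0.
have H' : `|I (x n) (ramp t h) - I (v n) (ramp t h)| @[n --> \oo] -->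
    `|I x0 (ramp t h) - I v0 (ramp t h)|.
  apply: cvg_norm; apply: cvgB.
    exact: tx.
  by apply: weak_cvg_tau => //; exact: tau_cvg_cst.
apply: (cvgr_to_le H'); near=> n.
have e0 : 0 <= e by apply: le_trans (xv n 0 _); rewrite // lexx ltW.
have cx := cadlag_cadlag_on (x n); have cv := cadlag_cadlag_on (v n).
rewrite -stieltjes_integralB; [|exact: cadlag_bounded_measurable..].
apply: le_trans (integral_continuous_bv_bound T0 (cadlag_onB cx cv) cr (M := e) _) _.
  by move=> s /andP[s0 sT]; apply: xv; rewrite s0 ltW.
rewrite ler_piMr// -lee_fin fineK ?tvnorm_ramp// ge0_fin_numE ?tvnorm_ge0//.
by case: cr.
Unshelve. all: by end_near. Qed.

Lemma tau_tested_S_cvg (x : nat -> cadlag T) (x0 : cadlag T) :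
  tau_tested x x0 -> x n T @[n --> \oo] --> x0 T ->
  exists phi : nat -> nat, phi @ \oo --> \oo /\ S_cvg (x \o phi) x0.
Proof.
(* Half of [1 / (m + 1)] is spent on the mesh, half on the thinning. *)
move=> tx xT; pose e (m : nat) : R := m.+1%:R^-1 / 2.
have e0 m : 0 < e m by rewrite divr_gt0.
have /choice[s sP] : forall mn : nat * nat, exists s,
    mesh (rmesh (x mn.2) (e mn.1)) 0 s /\ last 0 s = T.
  by move=> [m n]; have [s] := cadlag_rmesh T0 (e0 m) (cadlag_cadlag_on (x n)); exists s.
have sP1 m n : mesh ltmesh 0 (s (m, n)).
  by case: (sP (m, n)) => ms _; apply: mesh_sub ms => ? ? [].
pose l m n := jump_list (x n) (e m) (s (m, n)).
have lT m n : jump_times T (l m n) by apply: jump_list_times => //; case: (sP (m, n)).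
have xl m n t : 0 <= t <= T -> `|x n t - jumps T (l m n) t| <= m.+1%:R^-1.
  move=> tT; rewrite [leRHS]splitr; case: (sP (m, n)) => ms ls.
  by apply: (jump_list_approx ms ls (ltW (e0 m)) (ltW (e0 m)) tT).
have /choice[K KP] : forall m, exists K, \forall n \near \oo, (size (l m n) <= K)%N.
  (* At most [K] oscillations before [T], one possible jump at [T], and the initial value. *)
  move=> m; have [K KP] := tau_tested_oscillations T0 tx (e0 m); exists K.+2.
  apply: filterS KP => n xK; rewrite /= size_increments ltnS keep_size//.
  by case: (sP (m, n)).
have [M MP] := tau_tested_bounded T0 tx xT.
(* The coordinate [(m, i, b)] is the height or the time of the [i]-th jump in the [m]-th
   approximation. All [m] are treated together because the subsequence must be chosen before the
   tolerance [d]. *)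
pose u n (j : nat * nat * bool) : R :=
  let p := nth (0, 0) (l j.1.1 n) j.1.2 in if j.2 then p.1 else p.2.
have [|phi [p [phioo up]]] := @diagonal_subsequence R _ u.
  move=> [[m i] [|]]; rewrite /u/=.
    exists (2 * M); apply: filterS MP => n xM.
    have M0 : 0 <= M by apply: le_trans (xM 0 _); rewrite ?lexx ?(ltW T0).
    have [il|li] := ltnP i (size (l m n)); last by rewrite nth_default//= normr0 mulr_ge0.
    have [_ ls] := sP (m, n).
    by have /(all_nthP (0, 0)) := jump_list_bound (e m) (sP1 m n) ls xM; apply.
  exists T; near=> n; have [il|li] := ltnP i (size (l m n)).
    have /(all_nthP (0, 0))/(_ i il)/andP[p0 pT] := lT m n.
    by rewrite ger0_norm.
  by rewrite nth_default//= normr0 ltW.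
exists phi; split => // d d0.
have [m md] : exists m, m.+1%:R^-1 < d.
  by have /filter_ex := near_infty_natSinv_lt (PosNum d0); apply.
pose q i := (p (m, i, true), p (m, i, false)).
have q2 i : 0 <= (q i).2 <= T.
  have nT n : 0 <= u n (m, i, false) <= T.
    rewrite /u/=; have [il|li] := ltnP i (size (l m n)).
      by have /(all_nthP (0, 0)) := lT m n; apply.
    by rewrite nth_default//= lexx ltW.
  apply/andP; split.
    by apply: (cvgr_to_ge (up (m, i, false))); near=> k; case/andP: (nT (phi k)).
  by apply: (cvgr_to_le (up (m, i, false))); near=> k; case/andP: (nT (phi k)).
have q0T : jump_times T (mkseq q (K m)).
  by apply/allP => _ /mapP[i _ ->].
have w : weak_cvg (fun k => jumps_cadlag (lT m (phi k))) (jumps_cadlag q0T).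
  apply: (jumps_weak_cvg (p := q)) => //.
  - by have /phioo := KP m.
  - by move=> i; exact: (up (m, i, true)).
  - by move=> i; exact: (up (m, i, false)).
exists (fun k => jumps_cadlag (lT m (phi k))), (jumps_cadlag q0T); split => //.
- by split=> [k|]; exact: jumps_cadlag_bv.
- move=> k; apply/(supnorm_leP _ (_ \- _)) => t tT.
  exact: le_trans (xl m (phi k) t tT) (ltW md).
- apply/(supnorm_leP _ (_ \- _)) => t tT; apply: le_trans (ltW md).
  apply: (@weak_cvg_approx_limit (x \o phi) x0
    (fun k => jumps_cadlag (lT m (phi k))) (jumps_cadlag q0T)) => //.
  - move=> A cA; have xA := tx _ _ (fun=> cA) cA (tau_cvg_cst T0 cA).
    exact: (cvg_comp phi (fun n => I (x n) A) phioo xA).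
  - exact: (cvg_comp phi (fun n => x n T) phioo xT).
  - by move=> k; exact: jumps_cadlag_bv.
  - exact: jumps_cadlag_bv.
  - by move=> k r; exact: xl.
Unshelve. all: by end_near. Qed.

End compactness.

Theorem theorem3p3 (R : realType) (T : R) (T_gt0 : 0 < T)
    (x : nat -> cadlag T) (x0 : cadlag T) :
  (x @ \oo --> x0) <->
  (x n T @[n --> \oo] --> x0 T /\
   forall (A : nat -> R -> R) (A0 : R -> R),
     (forall n, continuous_bv T (A n)) -> continuous_bv T A0 ->
     tau_cvg T A A0 ->
     stieltjes_integral T (x n) (A n) @[n --> \oo] -->
       stieltjes_integral T x0 A0).
Proof.
split=> [xx0|[xT tx]].
  split; first exact: topological_end_cvg.
  by move=> A A0; exact: topological_tau_cvg.
(* If convergence fails, a subsequence stays outside an open [V] containing [x0]. It inherits the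
   test property, hence has a further subsequence that S-converges to [x0], although the complement
   of [V] is closed under such limits. *)
move=> U; rewrite nbhsE => -[V [oV Vx0] VU]; apply: contrapT => nU.
have /extract_increasing[N [phi phiP]] : forall k, exists n, (k <= n)%N /\ ~ V (x n).
  move=> k; apply: contrapT => nV; apply: nU; exists k => // n /= kn; apply: VU.
  by apply: contrapT => Vn; apply: nV; exists n.
have phiS k : (phi k < phi k.+1)%N by case: (phiP k).
have phi_ge k : (k <= phi k)%N.
  by elim: k => // k IHk; exact: leq_ltn_trans IHk (phiS k).
have phioo : phi @ \oo --> \oo.
  by apply/cvgnyPge => m; exists m => // k /= mk; exact: leq_trans (phi_ge k).
have [psi [_ xpsi]] := tau_tested_S_cvg T_gt0 (tau_tested_subseq T_gt0 phiS tx)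
  (cvg_comp phi (fun n => x n T) phioo xT).
by apply: (oV _ _ _ xpsi Vx0) => k /=; case: (phiP (psi k)).
Qed.
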